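(* Let $d\in\mathbb{N}$, let $\mathcal{I}$ be a countably infinite index set with a $d$-regular partition $\mathscr{P}=(\mathcal{I}_m)_{m\in\mathbb{N}}$. Let $p,q\in(0,\infty]$ and $\alpha\in\mathbb{R}$ with $\alpha>d\cdot(\frac12-\frac1p)_+$. Then $\mathcal{S}:=\mathcal{B}(0,1;\ell^{p,q}_\alpha(\mathscr{P}))\subset\ell^2(\mathcal{I})$ is compact (hence Borel measurable), its optimal compression rate is $s^\ast_{\ell^2(\mathcal{I})}(\mathcal{S})=\frac{\alpha}{d}-(\frac12-\frac1p)$, and there exists a Borel probability measure on $\mathcal{S}$ that is critical for $\mathcal{S}$ with respect to $\ell^2(\mathcal{I})$.
   Context: A partition $\mathscr{P}=(\mathcal{I}_m)_{m\in\mathbb{N}}$ of a countably infinite set $\mathcal{I}$ (disjoint union $\mathcal{I}=\biguplus_m\mathcal{I}_m$) is $d$-regular if there are $0<a<A<\infty$ with $a2^{dm}\le|\mathcal{I}_m|\le A2^{dm}$ for all $m\in\mathbb{N}$. For $\mathbf{x}\in\mathbb{R}^{\mathcal{I}}$ let $\mathbf{x}_m=(x_i)_{i\in\mathcal{I}_m}$ and $\|\mathbf{x}\|_{\ell^{p,q}_\alpha(\mathscr{P})}=\|(2^{\alpha m}\|\mathbf{x}_m\|_{\ell^p(\mathcal{I}_m)})_{m\in\mathbb{N}}\|_{\ell^q(\mathbb{N})}$; $\ell^{p,q}_\alpha(\mathscr{P})$ is the set of real sequences with finite quasi-norm, and $\mathcal{B}(0,1;\cdot)$ its closed unit ball. Rate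 distortion notions for a Banach space $\mathbf{X}$ and $\mathcal{S}\subset\mathbf{X}$: a codec is a sequence $((E_R,D_R))_{R}$, $E_R:\mathcal{S}\to\{0,1\}^R$, $D_R:\{0,1\}^R\to\mathbf{X}$, with distortion $\delta(E_R,D_R)=\sup_{\mathbf{x}\in\mathcal{S}}\|\mathbf{x}-D_R(E_R(\mathbf{x}))\|_{\mathbf{X}}$; $s^\ast_{\mathbf{X}}(\mathcal{S})=\sup\{s\ge0:\exists\text{ codec with }\sup_RR^s\delta(E_R,D_R)<\infty\}$. A Borel probability measure $\mathbb{P}$ on $\mathcal{S}$ (trace Borel $\sigma$-algebra) has growth order $s_0$ if for every $s>s_0$ there are $\varepsilon_0,c>0$ with $\mathbb{P}(\mathcal{S}\cap\mathcal{B}(\mathbf{x},\varepsilon;\mathbf{X}))\le2^{-c\varepsilon^{-1/s}}$ for all $\mathbf{x}\in\mathbf{X}$, $\varepsilon\in(0,\varepsilon_0)$; it is critical if $s_0=s^\ast_{\mathbf{X}}(\mathcal{S})$. *)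

(* Defs.v *)
From HB Require Import structures.
From mathcomp Require Import all_boot all_order all_algebra.
From mathcomp Require Import all_classical all_reals all_analysis.
Set Implicit Arguments. Unset Strict Implicit. Unset Printing Implicit Defensive.
Import Order.TTheory GRing.Theory Num.Theory.
Import numFieldNormedType.Exports.
Local Open Scope classical_set_scope.
Local Open Scope ring_scope.
Local Open Scope card_scope.

Section Defs.
Context {R : realType} {I : choiceType}.

(** A partition of I into blocks (I_m)_{m in nat}, encoded by the block map
    [blk : I -> nat] with I_m = blk^{-1}(m). *)
Definition block (blk : I -> nat) (m : nat) : set I := blk @^-1` [set m].

Definition d_regular (d : nat) (blk : I -> nat) : Prop :=
  exists a A : R, 0 < a /\ a < A /\
    forall m : nat, exists n : nat, block blk m #= `I_n /\
      a * (expn 2 (d * m.+1))%:R <= n%:R /\ n%:R <= A * (expn 2 (d * m.+1))%:R.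

(** exponents p in (0, oo] are extended reals with 0 < p *)
Definition inv_ext (p : \bar R) : R :=
  match p with | r%:E => r^-1 | _ => 0 end.

Definition block_norm (blk : I -> nat) (p : \bar R) (x : I -> R) (m : nat)
  : \bar R :=
  match p with
  | r%:E => (powR (\sum_(i \in block blk m) powR `|x i| r) r^-1)%:E
  | _ => ereal_sup ([set 0%E] `|` [set (`|x i|)%:E | i in block blk m])
  end.

Definition mixed_norm (blk : I -> nat) (p q : \bar R) (alpha : R)
  (x : I -> R) : \bar R :=
  let b m := ((powR 2 (alpha * m.+1%:R))%:E * block_norm blk p x m)%E in
  match q with
  | r%:E => poweR (\esum_(m in [set: nat]) poweR (b m) r) r^-1
  | _ => ereal_sup (range b)
  end.

Definition mixed_ball (blk : I -> nat) (p q : \bar R) (alpha : R)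
  : set (I -> R) := [set x | (mixed_norm blk p q alpha x <= 1)%E].

Definition l2norm (x : I -> R) : \bar R :=
  poweR (\esum_(i in [set: I]) ((x i) ^+ 2)%:E) 2^-1.
Definition l2 : set (I -> R) := [set x | (l2norm x < +oo)%E].
Definition l2dist (x y : I -> R) : \bar R := l2norm (fun i => x i - y i).

Definition l2_open (U : set (I -> R)) : Prop :=
  U `<=` l2 /\ forall x, U x -> exists e : R, 0 < e /\
    forall y, l2 y -> (l2dist x y < e%:E)%E -> U y.

Definition l2_compact (S : set (I -> R)) : Prop :=
  S `<=` l2 /\ forall F : set (set (I -> R)), F `<=` l2_open ->
    S `<=` \bigcup_(U in F) U ->
    exists G, [/\ finite_set G, G `<=` F & S `<=` \bigcup_(U in G) U].

Definition l2_borel : set (set (I -> R)) := <<s l2, l2_open >>.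
Definition trace_borel (S : set (I -> R)) : set (set (I -> R)) :=
  <<s S, [set S `&` U | U in l2_open] >>.

Definition l2_cball (x : I -> R) (e : R) : set (I -> R) :=
  [set y | l2 y /\ (l2dist x y <= e%:E)%E].

Definition distortion (S : set (I -> R)) (n : nat)
  (E : (I -> R) -> n.-tuple bool) (D : n.-tuple bool -> I -> R) : \bar R :=
  ereal_sup [set l2dist x (D (E x)) | x in S].

Definition codec_with_rate (S : set (I -> R)) (s : R) : Prop :=
  exists (E : forall n : nat, (I -> R) -> n.-tuple bool)
         (D : forall n : nat, n.-tuple bool -> I -> R),
    (forall n w, l2 (D n w)) /\
    exists C : R, forall n : nat, (0 < n)%N ->
      ((powR n%:R s)%:E * distortion S (E n) (D n) <= C%:E)%E.

Definition opt_rate (S : set (I -> R)) : \bar R :=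
  ereal_sup [set s%:E | s in [set s : R | 0 <= s /\ codec_with_rate S s]].

(** Borel probability measure on S (values only relevant on trace_borel S) *)
Definition borel_prob (S : set (I -> R)) (P : set (I -> R) -> R) : Prop :=
  [/\ P set0 = 0,
      (forall A, trace_borel S A -> 0 <= P A),
      P S = 1 &
      forall F : nat -> set (I -> R), (forall k, trace_borel S (F k)) ->
        trivIset setT F ->
        (fun n => \sum_(k < n) P (F k)) @ \oo --> P (\bigcup_k F k)].

Definition growth_order (S : set (I -> R)) (P : set (I -> R) -> R) (s0 : R)
  : Prop :=
  forall s : R, s0 < s -> exists e0 c : R, 0 < e0 /\ 0 < c /\
    forall (x : I -> R) (e : R), l2 x -> 0 < e -> e < e0 ->
      P (S `&` l2_cball x e) <= powR 2 (- (c * powR e (- s^-1))).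

Definition critical (S : set (I -> R)) (P : set (I -> R) -> R) : Prop :=
  exists s0 : R, growth_order S P s0 /\ opt_rate S = s0%:E.

End Defs.

(* Main.v *)
Require Import Defs.
From HB Require Import structures.
From mathcomp Require Import all_boot all_order all_algebra.
From mathcomp Require Import finmap.
From mathcomp Require Import all_classical all_reals all_analysis.
From mathcomp Require Import ring lra.
Set Implicit Arguments. Unset Strict Implicit. Unset Printing Implicit Defensive.
Import Order.TTheory GRing.Theory Num.Theory.
Import numFieldNormedType.Exports.
Local Open Scope classical_set_scope.
Local Open Scope ring_scope.

(** Write [s* = alpha/d - (1/2 - 1/p)].  For every [r] with
    [1/r < s* + 1/2 = alpha/d + 1/p] and [r <= p], the blockwise sums
    [sum_(i in I_m) |x_i|^r] decay geometrically in [m], uniformly on the ball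
    [S]; as [s* > 0] one can take [r < 2].  This one property yields
    - uniformly small [l2] tails, so that on [S] the [l2] topology is the product
      topology, in which [S] is closed, and compactness follows from Tychonoff;
    - codecs of every rate [s < 1/r - 1/2]: rounding the coordinates of finitely
      many blocks towards zero on a grid of step [t] costs at most [C t^(2-r)] in
      squared distance and leaves only [O(t^(-r))] nonzero coordinates, which are
      stored as (position, value) pairs.
    The measure is the law of [x_i = +- c_m] ([i] in [I_m]) with independent fair
    signs, the binary digits of a uniform point of [[0, 1[]; the [c_m] are, up to
    a polynomial factor in [m], as large as membership in [S] permits.  A ball of
    radius [e] has mass at most [2^((e/c_m)^2) (3/4)^|I_m|] for each [m], since
    every wrong sign costs [c_m^2] in squared distance; optimizing [m] gives
    growth order [s*].  Covering [S] by the [2^n] distortion balls of a codec then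
    bounds its rate by [s*]. *)

(** * Powers of two *)

Section real_facts.
Context {R : realType}.
Implicit Types x y : R.

Lemma pow2D x y : 2 `^ (x + y) = 2 `^ x * 2 `^ y :> R.
Proof. by rewrite powRD// implybE pnatr_eq0 orbT. Qed.

Lemma pow2_gt0 x : 0 < 2 `^ x :> R. Proof. exact: powR_gt0. Qed.

Lemma pow2_ge0 x : 0 <= 2 `^ x :> R. Proof. exact: powR_ge0. Qed.

Lemma pow2_natr n : 2 `^ n%:R = (2 ^ n)%N%:R :> R.
Proof. by rewrite powR_mulrn// natrX. Qed.

Lemma ler_pow2 x y : x <= y -> 2 `^ x <= 2 `^ y :> R.
Proof. by move=> xy; rewrite ler_powR// ler1n. Qed.

Lemma pow2_gt1 x : 0 < x -> 1 < 2 `^ x :> R.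
Proof.
by move=> x0; rewrite /powR pnatr_eq0/= expR_gt1 mulr_gt0// ln_gt0// ltr1n.
Qed.

(** The right side is the square of [exp (a x)] with [a = c ln 2 / 2], and [exp (a x) >= 1 + a x];
    the minimum of 1 and [a] bounds both coefficients from below. *)
Lemma pow2_quadratic c : 0 < c -> exists2 k : R, 0 < k &
  forall x, 0 <= x -> (k * (x + 1)) ^+ 2 <= 2 `^ (c * x).
Proof.
move=> c0.
have l0 : 0 < ln 2 :> R by rewrite ln_gt0// ltr1n.
pose a := c * ln 2 / 2.
have a0 : 0 < a by rewrite /a divr_gt0// mulr_gt0.
exists (Num.min 1 a); first by rewrite lt_min ltr01 a0.
move=> x x0; rewrite /powR pnatr_eq0/=.
have -> : c * x * ln 2 = a * x + a * x by rewrite /a; field.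
rewrite expRD -expr2.
have m0 : 0 <= Num.min 1 a by rewrite le_min ler01 ltW.
rewrite lerXn2r ?nnegrE ?expR_ge0//.
  by rewrite mulr_ge0// addr_ge0.
apply: (le_trans _ (expR_ge1Dx _)).
rewrite mulrDr mulr1 addrC lerD// ?ge_min ?lexx//.
by rewrite ler_wpM2r// ge_min lexx orbT.
Qed.

(** The quadratic bound leaves one factor [j + 1] to spare, which outgrows the constant
    [C / k^2]. *)
Lemma linear_le_pow2 (C c : R) : 0 < c ->
  exists j0 : nat, forall j, (j0 <= j)%N -> C * j.+1%:R <= 2 `^ (c * j%:R).
Proof.
move=> c0; have [k k0 kP] := pow2_quadratic c0.
exists (Num.truncn (`|C| / k ^+ 2)) => j jj.
apply: (le_trans _ (kP j%:R (ler0n _ _))).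
rewrite natr1 exprMn [X in _ <= _ * X]expr2 mulrA ler_wpM2r//.
apply: (le_trans (ler_norm _)).
rewrite mulrC -ler_pdivrMr ?exprn_gt0//.
by apply: ltW; apply: (lt_le_trans (truncnS_gt _)); rewrite ler_nat ltnS.
Qed.

(** Near 0 the estimate is direct; elsewhere the map is [exp (r ln |a|)]. The absolute value keeps
    the default values of [powR] at negative arguments out of play. *)
Lemma continuous_normr_powR (r : R) : 0 < r -> continuous (fun a : R => `|a| `^ r).
Proof.
move=> r0 a; have [->|a0] := eqVneq a 0.
  apply/cvgrPdist_lt => e e0; near=> y.
  rewrite normr0 powR0 ?gt_eqF// sub0r normrN ger0_norm ?powR_ge0//.
  have -> : e = (e `^ r^-1) `^ r by rewrite -powRrM mulVf ?gt_eqF// powRr1// ltW.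
  rewrite gt0_ltr_powR ?nnegrE ?powR_ge0//.
  near: y; apply: cvgr0_norm_lt; [exact: cvg_id|exact: powR_gt0].
have n0 : 0 < `|a| by rewrite normr_gt0.
have h : expR (r * ln `|y|) @[y --> a] --> expR (r * ln `|a|).
  apply: continuous_comp; last exact: continuous_expR.
  apply: cvgMl_tmp; apply: (@continuous_comp _ _ _ (@Num.norm R R) (@ln R)).
    exact: norm_continuous.
  exact: continuous_ln.
rewrite /continuous_at {2}/powR gt_eqF//.
apply: cvg_trans h; apply: near_eq_cvg; near=> y.
rewrite /powR normr_eq0 ifF//; apply/negbTE.
near: y; apply: cvgr_neq0 a0; exact: cvg_id.
Unshelve. all: by end_near. Qed.

(* Summed over a block, with a suitable [l], this replaces Hoelder's inequality. *)
Lemma powR_interpolation (a l r p : R) : 0 <= a -> 0 < l -> 0 < r -> r <= p ->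
  a `^ r <= l `^ r + l `^ (r - p) * a `^ p.
Proof.
move=> a0 l0 r0 rp; have [al|la] := leP a l.
  rewrite (@le_trans _ _ (l `^ r))//; first by rewrite ge0_ler_powR ?nnegrE// ltW.
  by rewrite lerDl mulr_ge0 ?powR_ge0.
rewrite -[X in X <= _]add0r lerD ?powR_ge0//.
have a1 : 0 < a by exact: lt_trans la.
have -> : a `^ r = a `^ (r - p) * a `^ p.
  by rewrite -powRD ?subrK// implybE gt_eqF ?orbT.
rewrite ler_wpM2r ?powR_ge0//.
rewrite -[r - p]opprB !powRN lef_pV2 ?posrE ?powR_gt0//.
by rewrite ge0_ler_powR ?nnegrE ?subr_ge0 ?(ltW l0) ?(ltW a1) ?(ltW la).
Qed.

(** Splitting [a^2 = a^(2-r) a^r] turns control of r-th powers into control of squares, with a gain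
    when [b] is small. Both the tails and the rounding errors are estimated this way. *)
Lemma sqr_le_powR (a b r : R) : 0 <= a -> a <= b -> 0 < r -> r < 2 ->
  a ^+ 2 <= b `^ (2 - r) * a `^ r.
Proof.
move=> a0 ab r0 r2; have [->|an0] := eqVneq a 0.
  by rewrite expr0n/= mulr_ge0// powR_ge0.
rewrite -powR_mulrn// -[X in a `^ X](subrK r) powRD; last first.
  by rewrite implybE an0 orbT.
rewrite ler_wpM2r ?powR_ge0// ge0_ler_powR ?nnegrE ?subr_ge0 ?(ltW r2)//.
exact: le_trans ab.
Qed.

Lemma sumr_const_seq (T : Type) (s : seq T) (c : R) :
  \sum_(i <- s) c = c * (size s)%:R.
Proof. by rewrite big_const_seq count_predT iter_addr_0 mulr_natr. Qed.

End real_facts.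

(** * The l2 norm and the coordinatewise topology *)

(** Replaces an unordered sum of nonnegative terms by its finite partial sums, so that estimates
    stay in the real numbers. *)
Definition sumle (R : realType) (T : choiceType) (f : T -> R) (C : R) :=
  forall X : {fset T}, \sum_(i <- X) f i <= C.

Lemma esum_leP (R : realType) (T : choiceType) (f : T -> R) (C : R) :
  (forall i, 0 <= f i) ->
  ((\esum_(i in [set: T]) (f i)%:E <= C%:E)%E <-> sumle f C).
Proof.
move=> f0; split=> [h X|h].
  rewrite -lee_fin -sumEFin; apply: le_trans h; apply: esum_ge.
  exists [set` X]; first by split.
  by rewrite fsbig_finite//= set_fsetK.
apply: ge_ereal_sup => _ [A [fA _] <-].
by rewrite fsbig_finite//= sumEFin lee_fin.
Qed.

Lemma cvg_sumr (R : realType) (T J : Type) (F : set_system T) {FF : Filter F}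
    (s : seq J) (f : J -> T -> R) (l : J -> R) :
  (forall j, f j x @[x --> F] --> l j) ->
  \sum_(j <- s) f j x @[x --> F] --> \sum_(j <- s) l j.
Proof.
move=> fl; elim: s => [|j s ih].
  by rewrite big_nil; under eq_fun do rewrite big_nil; exact: cvg_cst.
rewrite big_cons; under eq_fun do rewrite big_cons.
exact: cvgD.
Qed.

Section l2_facts.
Context {R : realType} {I : choiceType}.
Implicit Types (x y : I -> R) (e : R).

Lemma l2norm_leP x e : 0 <= e ->
  ((l2norm x <= e%:E)%E <-> sumle (fun i => x i ^+ 2) (e ^+ 2)).
Proof.
move=> e0; rewrite -esum_leP; last by move=> i; exact: sqr_ge0.
rewrite /l2norm.
have : (0 <= \esum_(i in [set: I]) (x i ^+ 2)%:E)%E.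
  by apply: esum_ge0 => i _; rewrite lee_fin sqr_ge0.
case: (\esum_(i in _) _)%E => [r||]// r0.
  rewrite poweR_EFin !lee_fin powR12_sqrt//.
  by rewrite -[X in Num.sqrt r <= X](ger0_norm e0) -sqrtr_sqr ler_sqrt ?exprn_ge0.
by rewrite poweRyr ?invr_neq0 ?pnatr_eq0.
Qed.

Lemma l2P x : l2 x <-> exists C, sumle (fun i => x i ^+ 2) C.
Proof.
split=> [|[C xC]].
  rewrite /l2/=; have : (0 <= l2norm x)%E by exact: poweR_ge0.
  case E : (l2norm x) => [r||]// r0 _; exists (r ^+ 2).
  by apply/l2norm_leP => //; rewrite E.
have C0 : 0 <= C by have := xC fset0; rewrite big_seq_fset0.
rewrite /l2/=; apply: (@le_lt_trans _ _ (Num.sqrt C)%:E); last exact: ltry.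
by apply/l2norm_leP; rewrite ?sqrtr_ge0// sqr_sqrtr.
Qed.

Lemma l2dist_lt x y e e' : 0 <= e' -> e' < e ->
  sumle (fun i => (x i - y i) ^+ 2) (e' ^+ 2) -> (l2dist x y < e%:E)%E.
Proof.
move=> e'0 e'e h; apply: (@le_lt_trans _ _ e'%:E); last by rewrite lte_fin.
exact/l2norm_leP.
Qed.

Lemma l2distC x y : l2dist x y = l2dist y x.
Proof.
rewrite /l2dist /l2norm; congr poweR; apply: eq_esum => i _.
by rewrite -sqrrN opprB.
Qed.

Lemma l2dist_coord x y e i : (l2dist x y < e%:E)%E -> `|x i - y i| < e.
Proof.
rewrite /l2dist; have : (0 <= l2norm (fun j => x j - y j)%R)%E by exact: poweR_ge0.
case E : (l2norm _) => [r||]// r0; rewrite lte_fin; apply: le_lt_trans.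
have /l2norm_leP : (l2norm (fun j => x j - y j)%R <= r%:E)%E by rewrite E.
move=> /(_ r0) /(_ [fset i]%fset); rewrite big_seq_fset1 => h.
by rewrite -ler_sqr ?nnegrE// real_normK// num_real.
Qed.

(* The neighbourhoods of [x] in the product topology on [I -> R]. *)
Definition fnbhs x : set_system (I -> R) :=
  filter_from [set c : {fset I} * R | 0 < c.2]
    (fun c => [set y | forall i, i \in c.1 -> `|x i - y i| < c.2]).

Global Instance fnbhs_filter x : Filter (fnbhs x).
Proof.
apply: filter_from_filter; first by exists (fset0, 1) => /=.
move=> [X a] [Y b] /= a0 b0; exists ((X `|` Y)%fset, Num.min a b) => /=.
  by rewrite lt_min a0.
move=> y h; split=> i iX.
  by have := h i; rewrite inE iX lt_min => /(_ isT)/andP[].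
by have := h i; rewrite inE iX orbT lt_min => /(_ isT)/andP[].
Qed.

Lemma fnbhs_coord x i : y i @[y --> fnbhs x] --> x i.
Proof.
apply/cvgrPdist_lt => e e0; exists ([fset i]%fset, e) => //= y; apply.
by rewrite inE.
Qed.

(** Closedness for the product topology, which is stronger than closedness in [l2]. *)
Definition fin_closed (Z : set (I -> R)) := forall x, ~ Z x -> fnbhs x (~` Z).

Lemma fin_closed_le (f : (I -> R) -> R) c :
  (forall x, f y @[y --> fnbhs x] --> f x) -> fin_closed [set x | f x <= c].
Proof.
move=> fc x /= /negP; rewrite -ltNge => cf.
have := fc x => /cvgr_gt /(_ _ cf); apply: filterS => y /= cy.
by apply/negP; rewrite -ltNge.
Qed.

Lemma fin_closed_bigcap T (D : set T) (Z : T -> set (I -> R)) :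
  (forall t, D t -> fin_closed (Z t)) -> fin_closed (\bigcap_(t in D) Z t).
Proof.
move=> Zc x nZ; have [t [Dt nZt]] : exists t, D t /\ ~ Z t x.
  apply: contrapT => h; apply: nZ => t Dt; apply: contrapT => nZt.
  by apply: h; exists t.
by have := Zc _ Dt _ nZt; apply: filterS => y ny Zy; exact: ny (Zy _ Dt).
Qed.

Lemma fin_closed_l2_open (Z : set (I -> R)) : fin_closed Z -> l2_open (l2 `\` Z).
Proof.
move=> Zc; split=> [x []//|x [l2x /Zc [[X e] /= e0 h]]].
exists e; split=> // y l2y xy; split=> //; apply: h => i _.
exact: l2dist_coord xy.
Qed.

Lemma fin_closed_l2_borel (S : set (I -> R)) : S `<=` l2 -> fin_closed S ->
  l2_borel S.
Proof.
move=> Sl2 Sc.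
(* The sigma-algebra is generated by open sets, so [S] is reached as the complement of one. *)
have -> : S = l2 `\` (l2 `\` S) by rewrite setDD; apply/esym/setIidr.
have [_ + _] := smallest_sigma_algebra (@l2 R I) l2_open; apply.
by apply: sub_sigma_algebra; exact: fin_closed_l2_open.
Qed.

(** The norm is a supremum of continuous functions of finitely many coordinates, hence lower
    semicontinuous for the product topology. *)
Lemma fin_closed_cball x e : 0 <= e -> fin_closed [set y | (l2dist x y <= e%:E)%E].
Proof.
move=> e0; rewrite (_ : [set _ | _] =
  \bigcap_(X in [set: {fset I}]) [set y | \sum_(i <- X) (x i - y i) ^+ 2 <= e ^+ 2]).
  apply: fin_closed_bigcap => X _; apply: fin_closed_le => y.
  apply: cvg_sumr => i; rewrite expr2; under eq_fun do rewrite expr2.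
  have h : x i - z i @[z --> fnbhs y] --> x i - y i.
    by apply: cvgB; [exact: cvg_cst|exact: fnbhs_coord].
  exact: cvgM.
apply/seteqP; split=> y /=.
  by move/l2norm_leP => /(_ e0) h X _; exact: h.
by move=> h; apply/l2norm_leP => // X; exact: h.
Qed.

Lemma trace_borel_cball (S : set (I -> R)) x e : S `<=` l2 -> 0 <= e ->
  trace_borel S (S `&` l2_cball x e).
Proof.
move=> Sl2 e0.
have -> : S `&` l2_cball x e =
    S `\` (S `&` (l2 `\` [set y | (l2dist x y <= e%:E)%E])).
  apply/seteqP; split=> [y [Sy [l2y yx]]|y [Sy h]]; first by split=> // -[_ []].
  split=> //; split; first exact: Sl2.
  by apply: contrapT => n; apply: h; split=> //; split => //; exact: Sl2.
have [_ + _] := smallest_sigma_algebra S [set S `&` U | U in l2_open]; apply.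
apply: sub_sigma_algebra; eexists; last reflexivity.
exact/fin_closed_l2_open/fin_closed_cball.
Qed.

(** The equismall-tails condition that characterizes relative compactness of bounded sets in [l2];
    finite sets [Y] suffice to express it. *)
Definition small_tails (S : set (I -> R)) := forall e, 0 < e ->
  exists X : {fset I}, forall x (Y : {fset I}), S x -> [disjoint Y & X]%fset ->
    \sum_(i <- Y) x i ^+ 2 <= e.

(** Closeness on a finite set of coordinates controls the head of the distance and the uniform tails
    control the rest, so within [S] a product neighbourhood of [x] lies in [U]. *)
Lemma small_tails_fnbhs (S U : set (I -> R)) x : small_tails S -> S `<=` l2 ->
  l2_open U -> S x -> U x -> fnbhs x (~` S `|` U).
Proof.
move=> St Sl2 [_ Uo] Sx Ux; have [e [e0 h]] := Uo _ Ux.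
(* Since [(x - y)^2 <= 2 x^2 + 2 y^2], two tails of [e^2 / 32] cost [e^2 / 8]; the head costs as
   much, and the total is [(e / 2)^2]. *)
have e1 : 0 < e ^+ 2 / 32 by rewrite divr_gt0// exprn_gt0.
have [X tX] := St _ e1.
(* The successor keeps the divisor nonzero when [X] is empty. *)
pose n : R := (size X).+1%:R.
exists (X, Num.sqrt (e ^+ 2 / 8 / n)).
  by rewrite /= sqrtr_gt0 !divr_gt0// exprn_gt0.
move=> y /= yX; have [Sy|] := pselect (S y); last by left.
right; apply: h; first exact: Sl2.
apply: (@l2dist_lt _ _ _ (e / 2)) => //; [lra|lra|move=> Y].
rewrite (big_fsetID _ (mem X))/=.
set Y2 := [fset x in Y | x \notin X]%fset; set Y1 := [fset _ in Y | _]%fset.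
have -> : (e / 2) ^+ 2 = e ^+ 2 / 8 + (2 * (e ^+ 2 / 32) + 2 * (e ^+ 2 / 32)).
  by field.
apply: lerD; last first.
  apply: (@le_trans _ _ (2 * \sum_(i <- Y2) (x i) ^+ 2 +
                         2 * \sum_(i <- Y2) (y i) ^+ 2)).
    rewrite !mulr_sumr -big_split/=; apply: ler_sum => i _.
    rewrite -subr_ge0.
    have -> : 2 * x i ^+ 2 + 2 * y i ^+ 2 - (x i - y i) ^+ 2 = (x i + y i) ^+ 2.
      by ring.
    exact: sqr_ge0.
  by rewrite lerD// ler_pM2l// tX//; apply/fdisjointP => i; rewrite !inE => /andP[].
apply: (@le_trans _ _ (\sum_(i <- Y1) (e ^+ 2 / 8 / n))).
  rewrite !big_seq; apply: ler_sum => i; rewrite !inE => /andP[_ /yX iX].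
  rewrite -[X in _ <= X]sqr_sqrtr ?divr_ge0 ?exprn_ge0 ?(ltW e0)//.
  by rewrite -[X in X <= _](@real_normK _ (_ - _)) ?num_real// lerXn2r ?nnegrE ?sqrtr_ge0// ltW.
rewrite sumr_const_seq.
rewrite [_ / n * _]mulrAC ler_pdivrMr ?ltr0n// ler_wpM2l ?divr_ge0 ?exprn_ge0 ?(ltW e0)//.
by rewrite ler_nat ltnW// ltnS fsubset_leq_card//; apply/fsubsetP => i; rewrite !inE => /andP[].
Qed.

Import ArrowAsProduct.

Lemma fnbhs_nbhs x (V : set (I -> R)) :
  fnbhs x V -> nbhs (x : prod_topology (fun _ : I => R^o)) V.
Proof.
move=> [[X e] /= e0] XV.
have h i : i \in X -> nbhs (x : prod_topology (fun _ : I => R^o))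
    [set y : I -> R | `|x i - y i| < e].
  move=> iX; have := @proj_continuous I (fun _ => R^o) i x.
  by move/cvgrPdist_lt => /(_ _ e0).
have H := @filter_bigI _ _ X (fun i => [set y : I -> R | `|x i - y i| < e]) _
  (nbhs_filter (x : prod_topology (fun _ : I => R^o))) h.
move: H; apply: filterS => y /= yX; apply: XV => i iX; exact: yX.
Qed.

Lemma small_tails_l2_compact (S : set (I -> R)) (K : R) : small_tails S ->
  S `<=` l2 -> fin_closed S -> (forall x i, S x -> `|x i| <= K) -> l2_compact S.
Proof.
move=> St Sl2 Sc SK; split=> // F Fo SF.
pose T : topologicalType := prod_topology (fun _ : I => R^o).
have cS : compact (S : set T).
  apply: (@subclosed_compact T _ [set f : T | forall i, `[- K, K]%classic (f i)]).
  - rewrite -[S]setCK; apply: open_closedC.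
    by rewrite openE => x /Sc /fnbhs_nbhs.
  - apply: (@tychonoff I (fun _ => R^o) (fun _ => `[- K, K]%classic)) => i.
    exact: segment_compact.
  - by move=> x /SK xK i; rewrite /= in_itv/= -ler_norml; exact: xK.
pose sub (G : set (set (I -> R))) := finite_set G /\ G `<=` F.
(* Finite subfamilies of [F] are directed by inclusion. Along this filter, near-covering compactness
   makes the local statement that some member contains [x] hold for all of [S] at once. *)
pose FF : set_system (set (set (I -> R))) :=
  filter_from sub (fun G => [set G' | sub G' /\ G `<=` G']).
have FFF : Filter FF.
  apply: filter_from_filter; first by exists set0; split.
  move=> G1 G2 [f1 s1] [f2 s2]; exists (G1 `|` G2).
    by split; [rewrite finite_setU|rewrite subUset].
  by move=> G' [sG' +]; rewrite subUset => -[? ?]; split.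
have /compact_near_coveringP := cS.
move=> /(_ _ FF (fun G x => S x -> exists2 U, G U & U x) FFF) [].
  move=> x Sx; have [U FU Ux] := SF x Sx.
  exists (~` S `|` U, [set G' | sub G' /\ [set U] `<=` G']).
    split=> /=; first by apply: fnbhs_nbhs; apply: small_tails_fnbhs => //; exact: Fo.
    exists [set U] => //; split; first exact: finite_set1.
    by move=> _ ->.
  move=> [y G] /= [SUy [_ UG]] Sy; exists U; first exact: UG.
  by case: SUy.
move=> G [fG GF] /(_ G) h; exists G; split=> // x Sx.
by have [|U GU Ux] := h _ x Sx Sx; [split|exists U].
Qed.

End l2_facts.

(** * Blocks and the mixed norm *)

Lemma cvg_maxr (R : realType) (T : Type) (F : set_system T) {FF : Filter F}
    (f g : T -> R) (a b : R) : f x @[x --> F] --> a -> g x @[x --> F] --> b ->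
  Num.max (f x) (g x) @[x --> F] --> Num.max a b.
Proof.
move=> /cvgrPdist_lt fa /cvgrPdist_lt gb; apply/cvgrPdist_lt => e e0.
have := fa _ e0; have := gb _ e0; apply: filterS2 => x.
rewrite !ltr_norml; case: (leP a b); case: (leP (f x) (g x)); lra.
Qed.

Section blocks.
Context {R : realType} {I : choiceType} (blk : I -> nat).
Hypothesis blkfin : forall m, finite_set (block blk m).
Implicit Types (x : I -> R) (m : nat).

Definition fblock m : {fset I} := fset_set (block blk m).

Lemma in_fblock m i : (i \in fblock m) = (blk i == m).
Proof.
rewrite in_fset_set//; apply/idP/eqP => [|im]; first by rewrite inE.
by rewrite inE.
Qed.

Lemma sum_fset_blocks (f : I -> R) (L L' : nat) (X : {fset I}) :
  (forall i, 0 <= f i) ->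
  (forall i, i \in X -> (L <= blk i < L')%N) ->
  \sum_(i <- X) f i <= \sum_(L <= m < L') \sum_(i <- fblock m) f i.
Proof.
move=> f0 XL.
have -> : \sum_(i <- X) f i = \sum_(L <= m < L') \sum_(i <- X | blk i == m) f i.
  rewrite (exchange_big_dep xpredT)//= !big_seq; apply: eq_bigr => i iX.
  rewrite [RHS]big_mkcond (bigD1_seq (blk i)) ?iota_uniq ?mem_index_iota ?XL//=.
  by rewrite eqxx big1 ?addr0// => m; rewrite eq_sym => /negbTE ->.
apply: ler_sum => m _.
have -> : \sum_(i <- X | blk i == m) f i = \sum_(i <- fblock m | i \in X) f i.
  rewrite big_fset_condE [RHS]big_fset_condE.
  apply: eq_fbigl => i; rewrite !inE /= in_fblock andbC//.
rewrite [leRHS](bigID (mem X))/= lerDl sumr_ge0// => i _; exact: f0.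
Qed.

(** A geometric tail summed by telescoping: [2^(-g m) - 2^(-g (m+1))] equals
    [(2^g - 1) 2^(-g (m+1))]. *)
Lemma sum_fset_tail (f : I -> R) (C g : R) (L : nat) (Y : {fset I}) :
  0 < g -> (forall i, 0 <= f i) ->
  (forall m, \sum_(i <- fblock m) f i <= C * 2 `^ (- (g * m.+1%:R))) ->
  (forall i, i \in Y -> (L <= blk i)%N) ->
  \sum_(i <- Y) f i <= C / (2 `^ g - 1) * 2 `^ (- (g * L%:R)).
Proof.
move=> g0 f0 fC YL.
have gg : 0 < 2 `^ g - 1 :> R.
  by rewrite subr_gt0 pow2_gt1.
have C0 : 0 <= C.
  rewrite -(pmulr_lge0 _ (pow2_gt0 (- (g * 1%:R)))); apply: le_trans (fC 0%N).
  by apply: sumr_ge0 => i _.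
(* Beyond every block met by [Y], and at least [L] so that the telescoping range is valid when [Y]
   is empty. *)
pose L' := (maxn L (\max_(i <- Y) (blk i).+1))%N.
apply: (le_trans (@sum_fset_blocks f L L' Y f0 _)).
  move=> i iY; rewrite YL//= /L' leq_max; apply/orP; right.
  exact: (@leq_bigmax_seq _ _ xpredT (fun i => (blk i).+1) _ iY).
apply: (@le_trans _ _ (\sum_(L <= m < L') (C / (2 `^ g - 1) *
   (- 2 `^ (- (g * m.+1%:R)) - - 2 `^ (- (g * m%:R)))))).
  apply: ler_sum => m _; apply: (le_trans (fC m)).
  have -> : 2 `^ (- (g * m%:R)) = 2 `^ g * 2 `^ (- (g * m.+1%:R)) :> R.
    by rewrite -pow2D -natr1; congr (_ `^ _); ring.
  by rewrite le_eqVlt; apply/orP; left; apply/eqP; field; rewrite gt_eqF.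
rewrite -mulr_sumr telescope_sumr ?leq_maxl// ler_wpM2l//.
  by rewrite divr_ge0// ltW.
by rewrite opprK gerDr oppr_le0 pow2_ge0.
Qed.

(* As in [block_norm], any [p] other than a real number is read as [+oo]. *)
Definition bnorm (p : \bar R) x m : R :=
  match p with
  | r%:E => (\sum_(i <- fblock m) `|x i| `^ r) `^ r^-1
  | _ => \big[Num.max/0]_(i <- fblock m) `|x i|
  end.

Lemma bnorm_ge0 p x m : 0 <= bnorm p x m.
Proof.
case: p => [r||] /=; first exact: powR_ge0.
all: elim/big_rec: _ => // i y _ y0; by rewrite le_max y0 orbT.
Qed.

Lemma block_normE p x m : block_norm blk p x m = (bnorm p x m)%:E.
Proof.
have infty : ereal_sup ([set 0%E] `|` [set (`|x i|)%:E | i in block blk m]) =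
    (\big[Num.max/0]_(i <- fblock m) `|x i|)%:E.
  apply/eqP; rewrite eq_le; apply/andP; split.
    apply: ge_ereal_sup => _ [->|[i /= im <-]].
      by rewrite lee_fin; exact: (bnorm_ge0 +oo).
    by rewrite lee_fin; apply: (le_bigmax_seq 0 i xpredT (fun j => `|x j|)) => //; rewrite in_fblock; exact/eqP.
  rewrite big_seq; elim/big_ind: _.
  - by apply: ereal_sup_ubound; left.
  - by move=> a b ha hb; case: (leP a b).
  - move=> i; rewrite in_fblock => /eqP im; apply: ereal_sup_ubound; right.
    by exists i.
by case: p => [r||]//=; rewrite fsbig_finite.
Qed.

Lemma bnorm_cvg p x m : (0 < p)%E ->
  bnorm p y m @[y --> fnbhs x] --> bnorm p x m.
Proof.
have h i : `|y i| @[y --> fnbhs x] --> `|x i| by apply: cvg_norm; exact: fnbhs_coord.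
have sup : \big[Num.max/0]_(i <- fblock m) `|y i| @[y --> fnbhs x] -->
    \big[Num.max/0]_(i <- fblock m) `|x i|.
  elim: (fblock m : seq I) => [|i s ih].
    by rewrite big_nil; under eq_fun do rewrite big_nil; exact: cvg_cst.
  by rewrite big_cons; under eq_fun do rewrite big_cons; exact: cvg_maxr.
case: p => [r||]//=; rewrite lte_fin => r0.
have sn y : \sum_(i <- fblock m) `|y i| `^ r = `|\sum_(i <- fblock m) `|y i| `^ r| :> R.
  by rewrite ger0_norm// sumr_ge0// => i _; exact: powR_ge0.
rewrite sn; under eq_fun do rewrite sn.
have rV : 0 < r^-1 by rewrite invr_gt0.
apply: (@cvg_comp _ _ _ (fun y : I -> R => \sum_(i <- fblock m) `|y i| `^ r)
   (fun a : R => `|a| `^ r^-1) _ (nbhs (\sum_(i <- fblock m) `|x i| `^ r))); last first.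
  exact: continuous_normr_powR.
apply: cvg_sumr => i.
apply: (@cvg_comp _ _ _ (fun y : I -> R => y i)
   (fun a : R => `|a| `^ r) _ (nbhs (x i))); first exact: fnbhs_coord.
exact: continuous_normr_powR.
Qed.

(** * The unit ball in terms of its block norms *)

Section ball.
Variables (p q : \bar R) (alpha : R).
Hypotheses (p0 : (0 < p)%E) (q0 : (0 < q)%E).
Let S : set (I -> R) := mixed_ball blk p q alpha.
Let v x m := 2 `^ (alpha * m.+1%:R) * bnorm p x m.

Let v_ge0 x m : 0 <= v x m.
Proof. by rewrite mulr_ge0 ?pow2_ge0 ?bnorm_ge0. Qed.

Lemma mixed_ballP x : S x <->
  match q with
  | r%:E => sumle (fun m => v x m `^ r) 1
  | _ => forall m, v x m <= 1
  end.
Proof.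
have sup : ((ereal_sup (range (fun m => (2 `^ (alpha * m.+1%:R))%:E * block_norm blk p x m)) <= 1)
    <-> forall m, (v x m <= 1)%R)%E.
  split=> [h m|h].
    rewrite -lee_fin; apply: le_trans h; apply: ereal_sup_ubound.
    by exists m => //; rewrite block_normE.
  by apply: ge_ereal_sup => _ [m _ <-]; rewrite block_normE lee_fin; exact: h.
rewrite /S /mixed_ball /mixed_norm/=; move: q0; case: q => [r||]//=.
rewrite lte_fin => r0.
under eq_esum do rewrite block_normE poweR_EFin.
rewrite -esum_leP; last by move=> m; exact: powR_ge0.
have : (0 <= \esum_(m in [set: nat]) (v x m `^ r)%:E)%E.
  by apply: esum_ge0 => m _; rewrite lee_fin powR_ge0.
have rV : 0 < r^-1 by rewrite invr_gt0.
rewrite /v; case: (esum _ _) => [t||]// t0; last first.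
  by rewrite poweRyr ?gt_eqF.
rewrite poweR_EFin !lee_fin; rewrite lee_fin in t0; split=> h.
  have tE : t = (t `^ r^-1) `^ r by rewrite -powRrM mulVf ?gt_eqF// powRr1.
  rewrite tE -[leRHS](congr1 (fun f => f r) (powR1 R)).
  by rewrite ge0_ler_powR ?nnegrE ?powR_ge0 ?(ltW r0).
by rewrite -[leRHS](congr1 (fun f => f r^-1) (powR1 R)) ge0_ler_powR ?nnegrE ?(ltW rV).
Qed.

(** The ball is cut out by conditions that are each continuous in the coordinates of finitely many
    blocks. *)
Lemma mixed_ball_fin_closed : fin_closed S.
Proof.
have vc m x : v y m @[y --> fnbhs x] --> v x m.
  by apply: cvgMl_tmp; exact: bnorm_cvg.
case E : q => [r||]; move: q0; rewrite E// ?lte_fin => r0.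
  have -> : S = \bigcap_(X in [set: {fset nat}])
      [set x | \sum_(m <- X) v x m `^ r <= 1].
    apply/seteqP; split=> x.
      by move=> /mixed_ballP; rewrite E => h X _; exact: h.
    by move=> h; apply/mixed_ballP; rewrite E => X; exact: h.
  apply: fin_closed_bigcap => X _; apply: fin_closed_le => x; apply: cvg_sumr => m.
  have vn y : v y m = `|v y m| by rewrite ger0_norm.
  rewrite vn; under eq_fun do rewrite vn.
  apply: (@cvg_comp _ _ _ (fun y : I -> R => v y m)
    (fun a : R => `|a| `^ r) _ (nbhs (v x m))); first exact: vc.
  exact: continuous_normr_powR.
have -> : S = \bigcap_(m in [set: nat]) [set x | v x m <= 1].
  apply/seteqP; split=> x.
    by move=> /mixed_ballP; rewrite E => h X _; exact: h.
  by move=> h; apply/mixed_ballP; rewrite E => X; exact: h.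
by apply: fin_closed_bigcap => m _; exact: fin_closed_le.
Qed.

(** The inclusion in the ball with [q = +oo]; the decay estimates use [q] only through it. *)
Lemma mixed_ball_bnorm x m : S x -> bnorm p x m <= 2 `^ (- (alpha * m.+1%:R)).
Proof.
move=> /mixed_ballP Sx.
suff : v x m <= 1 by rewrite /v powRN -ler_pdivlMl ?pow2_gt0// mulr1.
move: Sx q0; case: q => [r||]// h; rewrite lte_fin => r0.
have := h [fset m]%fset; rewrite big_seq_fset1 -[leRHS](congr1 (fun f => f r) (powR1 R)); apply: contraTT.
by rewrite -!ltNge => ?; rewrite gt0_ltr_powR ?nnegrE.
Qed.

End ball.
End blocks.

(** * Geometric decay of the block sums *)

Section decay.
Context {R : realType} {I : choiceType} (blk : I -> nat).
Hypothesis blkfin : forall m, finite_set (block blk m).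
Variables (S : set (I -> R)) (r g C : R).
Hypotheses (r0 : 0 < r) (r2 : r < 2) (g0 : 0 < g).
Hypothesis Sdecay : forall x m, S x ->
  \sum_(i <- fblock blk m) `|x i| `^ r <= C * 2 `^ (- (g * m.+1%:R)).

(** [C'] will bound the sum of [|x_i|^r] over all indices, and [K] each single [|x_i|]. *)
Let C' := C / (2 `^ g - 1).
Let K := C' `^ r^-1.

Lemma decay_sumle x : S x -> sumle (fun i => `|x i| `^ r) C'.
Proof.
move=> Sx X; have := @sum_fset_tail _ _ _ blkfin (fun i => `|x i| `^ r) C g 0 X.
rewrite mulr0 oppr0 powRr0 mulr1; apply=> //.
by move=> m; exact: Sdecay.
Qed.

Lemma decay_bound x i : S x -> `|x i| <= K.
Proof.
move=> Sx; have := @decay_sumle x Sx [fset i]%fset.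
rewrite big_seq_fset1 => h.
have -> : `|x i| = (`|x i| `^ r) `^ r^-1 by rewrite -powRrM mulfV ?gt_eqF// powRr1.
apply: ge0_ler_powR; rewrite ?nnegrE ?powR_ge0 ?invr_ge0 ?(ltW r0)//.
exact: le_trans h; exact: powR_ge0.
Qed.

Lemma decay_sqr_tail x L (Y : {fset I}) : S x ->
  (forall i, i \in Y -> (L <= blk i)%N) ->
  \sum_(i <- Y) x i ^+ 2 <= K `^ (2 - r) * (C' * 2 `^ (- (g * L%:R))).
Proof.
move=> Sx YL.
apply: (@le_trans _ _ (\sum_(i <- Y) K `^ (2 - r) * `|x i| `^ r)).
  apply: ler_sum => i _; rewrite -[x i ^+ 2]real_normK ?num_real//.
  by apply: sqr_le_powR => //; exact: decay_bound.
rewrite -mulr_sumr ler_wpM2l ?powR_ge0//; apply: sum_fset_tail => //.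
by move=> m; exact: Sdecay.
Qed.

Lemma decay_sub_l2 : S `<=` l2.
Proof.
move=> x Sx; apply/l2P; exists (K `^ (2 - r) * (C' * 2 `^ (- (g * 0%:R)))) => X.
exact: (@decay_sqr_tail x 0%N).
Qed.

Lemma decay_small_tails : small_tails S.
Proof.
move=> e e0; pose D := `|K `^ (2 - r) * C'| / e.
have [L DL] : exists L : nat, D <= 2 `^ (g * L%:R).
  have [j0 /(_ j0 (leqnn _)) h] := linear_le_pow2 D g0; exists j0.
  apply: le_trans h; rewrite ler_peMr ?ler1n//.
  by rewrite divr_ge0 ?normr_ge0 ?ltW.
exists (\bigcup_(m <- iota 0 L) fblock blk m)%fset => x Y Sx YX.
apply: (le_trans (@decay_sqr_tail x L Y Sx _)).
  move=> i iY; rewrite leqNgt; apply/negP => iL.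
  move/fdisjointP : YX => /(_ i iY) /negP; apply.
  apply/bigfcupP; exists (blk i); first by rewrite mem_iota andbT.
  by rewrite in_fblock.
rewrite mulrA powRN ler_pdivrMr ?pow2_gt0//.
apply: (le_trans (ler_norm _)).
by rewrite -ler_pdivrMl// mulrC.
Qed.

Lemma decay_l2_compact : fin_closed S -> l2_compact S.
Proof.
move=> Sc; apply: (@small_tails_l2_compact _ _ _ K) => //.
- exact: decay_small_tails.
- exact: decay_sub_l2.
- by move=> x i; exact: decay_bound.
Qed.

End decay.

(** * Decay of the block sums on the unit ball *)

Section ball_decay.
Context {R : realType} {I : choiceType} (blk : I -> nat).
Hypothesis blkfin : forall m, finite_set (block blk m).
Variables (p q : \bar R) (alpha A : R) (d : nat).
Hypotheses (p0 : (0 < p)%E) (q0 : (0 < q)%E).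
Hypothesis cardA : forall m, #|` fblock blk m|%:R <= A * 2 `^ (d%:R * m.+1%:R).

(** Hoelder's inequality on a block of at most [A 2^(d (m+1))] entries. The rate is positive exactly
    when [1/r < alpha/d + 1/p]. *)
Lemma mixed_ball_decay (r : R) x m : 0 < r -> r * inv_ext p <= 1 ->
  mixed_ball blk p q alpha x ->
  \sum_(i <- fblock blk m) `|x i| `^ r <=
  (A + 1) * 2 `^ (- ((r * (alpha + d%:R * inv_ext p) - d%:R) * m.+1%:R)).
Proof.
move=> r0 rp /(mixed_ball_bnorm blkfin q0 m).
set M : R := m.+1%:R; have := cardA m; rewrite -/M => cA.
case: p p0 rp => [s||]//=.
  rewrite lte_fin => s0; rewrite ler_pdivrMr// mul1r => rs bm.
  (* The common modulus of the entries when an l^s norm of [2^(-alpha M)] is spread evenly over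
     [2^(d M)] places; it balances the two terms of the interpolation. *)
  pose l : R := 2 `^ (- ((alpha + d%:R / s) * M)).
  have sm : \sum_(i <- fblock blk m) `|x i| `^ s <= 2 `^ (- (alpha * s * M)).
    have sg0 : 0 <= \sum_(i <- fblock blk m) `|x i| `^ s.
      by rewrite sumr_ge0// => i _; exact: powR_ge0.
    have -> : \sum_(i <- fblock blk m) `|x i| `^ s =
      ((\sum_(i <- fblock blk m) `|x i| `^ s) `^ s^-1) `^ s.
      by rewrite -powRrM mulVf ?gt_eqF// powRr1.
    have -> : - (alpha * s * M) = - (alpha * M) * s by ring.
    by rewrite powRrM ge0_ler_powR ?nnegrE ?powR_ge0 ?(ltW s0).
  apply: (@le_trans _ _ (\sum_(i <- fblock blk m) (l `^ r + l `^ (r - s) * `|x i| `^ s))).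
    by apply: ler_sum => i _; apply: powR_interpolation => //; exact: pow2_gt0.
  rewrite big_split/= sumr_const_seq -mulr_sumr mulrDl mul1r lerD//.
    apply: (@le_trans _ _ (l `^ r * (A * 2 `^ (d%:R * M)))).
      by rewrite ler_wpM2l ?powR_ge0.
    rewrite mulrCA -powRrM -pow2D.
    suff -> : - ((alpha + d%:R / s) * M) * r + d%:R * M =
       - ((r * (alpha + d%:R / s) - d%:R) * M) by [].
    by ring.
  apply: (@le_trans _ _ (l `^ (r - s) * 2 `^ (- (alpha * s * M)))).
    by rewrite ler_wpM2l ?powR_ge0.
  rewrite -powRrM -pow2D.
  suff -> : - ((alpha + d%:R / s) * M) * (r - s) - alpha * s * M =
       - ((r * (alpha + d%:R / s) - d%:R) * M) by [].
  by field; rewrite gt_eqF.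
move=> _ _ bm.
apply: (@le_trans _ _ (\sum_(i <- fblock blk m) 2 `^ (- (alpha * M * r)))).
  rewrite !big_seq; apply: ler_sum => i im.
  rewrite -mulNr powRrM ge0_ler_powR ?nnegrE ?powR_ge0 ?(ltW r0)//.
  apply: le_trans bm.
  exact: (le_bigmax_seq 0 i xpredT (fun j => `|x j|)).
rewrite sumr_const_seq.
apply: (@le_trans _ _ (2 `^ (- (alpha * M * r)) * (A * 2 `^ (d%:R * M)))).
  by rewrite ler_wpM2l ?powR_ge0.
rewrite mulrCA -pow2D mulrDl mul1r.
have -> : - (alpha * M * r) + d%:R * M =
    - ((r * (alpha + d%:R * 0) - d%:R) * M) by ring.
by rewrite lerDl pow2_ge0.
Qed.

End ball_decay.

(** * Codecs *)

(** Word lengths [2^j] suffice: a length [n] uses the codebook for the integer part of [log2 n], at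
    the price of a factor [2^s]. The exponent [2 s] appears because distances are squared. *)
Lemma codec_of_covering (R : realType) (I : choiceType) (S : set (I -> R))
    (s D : R) : 0 <= s -> 0 <= D ->
  (forall j : nat, exists Y : seq (I -> R), (size Y <= 2 ^ (2 ^ j))%N /\
    forall x, S x -> exists y, [/\ y \in Y, l2 y &
      sumle (fun i => (x i - y i) ^+ 2) (D * 2 `^ (- (2 * s * j%:R)))]) ->
  codec_with_rate S s.
Proof.
move=> s0 D0 /choice[Y YP].
pose l n : seq (n.-tuple bool) := enum {: n.-tuple bool}.
pose J n := trunc_log 2 n.
have /choice[c cP] : forall j, exists f : (I -> R) -> I -> R, forall x, S x ->
    [/\ f x \in Y j, l2 (f x) &
      sumle (fun i => (x i - f x i) ^+ 2) (D * 2 `^ (- (2 * s * j%:R)))].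
  move=> j.
  have h x : exists y, S x -> [/\ y \in Y j, l2 y &
      sumle (fun i => (x i - y i) ^+ 2) (D * 2 `^ (- (2 * s * j%:R)))].
    have [Sx|nSx] := pselect (S x); last by exists x.
    by have [_ /(_ x Sx)[y yP]] := YP j; exists y.
  by have [f fP] := choice h; exists f.
pose zero : I -> R := fun=> 0.
pose E n (x : I -> R) : n.-tuple bool :=
  nth [tuple of nseq n false] (l n) (index (c (J n) x) (Y (J n))).
pose D' n (w : n.-tuple bool) : I -> R :=
  let y := nth zero (Y (J n)) (index w (l n)) in
  (* Words that name no codeword, or one outside [l2], must still decode into [l2]. *)
  if `[< l2 y >] then y else zero.
have D'E n x : (0 < n)%N -> S x -> D' n (E n x) = c (J n) x.
  move=> n0 Sx; have [cY l2c _] := cP (J n) x Sx.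
  rewrite /D' /E index_uniq ?enum_uniq ?nth_index//; first by rewrite asboolT.
  rewrite -cardE card_tuple card_bool.
  rewrite (leq_trans _ (leq_trans (proj1 (YP (J n))) _)) ?index_mem//.
  by rewrite leq_exp2l// trunc_logP.
exists E, D'; split.
  move=> n w; rewrite /D'; case: ifPn => [/asboolP//|_].
  by apply/l2P; exists 0 => X; rewrite big1// => i _; rewrite expr0n.
exists (Num.sqrt D * 2 `^ s) => n n0.
have dist : (distortion S (E n) (D' n) <= (Num.sqrt D * 2 `^ (- (s * (J n)%:R)))%:E)%E.
  apply: ge_ereal_sup => _ [x Sx <-]; rewrite D'E//.
  apply/l2norm_leP; first by rewrite mulr_ge0 ?sqrtr_ge0 ?pow2_ge0.
  rewrite exprMn sqr_sqrtr// expr2 -pow2D.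
  have -> : - (s * (J n)%:R) - s * (J n)%:R = - (2 * s * (J n)%:R) by ring.
  by have [] := cP (J n) x Sx.
apply: (le_trans (lee_wpmul2l _ dist)); first by rewrite lee_fin powR_ge0.
rewrite -EFinM lee_fin mulrCA ler_wpM2l ?sqrtr_ge0//.
(* From [n < 2^(J n + 1)]. *)
have -> : 2 `^ s = 2 `^ ((J n).+1%:R * s) * 2 `^ (- (s * (J n)%:R)).
  by rewrite -pow2D -natr1; congr (_ `^ _); ring.
rewrite ler_wpM2r ?pow2_ge0// powRrM pow2_natr ge0_ler_powR ?nnegrE// ler_nat.
by rewrite ltnW// trunc_log_ltn.
Qed.

(** * Lists of sparse vectors *)

Section sparse.
Context {R : realType} {I : choiceType}.

Definition add_entry (y : I -> R) (c : option (I * R)) : I -> R :=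
  if c is Some (i, a) then fun j => if j == i then y j + a else y j else y.

(** Each of [k] rounds adds one entry of [P] or nothing, the latter to allow smaller supports.
    Repetitions are harmless, as only an upper bound on the number of codewords matters. *)
Fixpoint sparse_seq (P : seq (I * R)) (k : nat) : seq (I -> R) :=
  if k is k'.+1 then
    [seq add_entry y c | y <- sparse_seq P k', c <- None :: [seq Some c | c <- P]]
  else [:: fun=> 0].

Lemma size_sparse_seq P k : size (sparse_seq P k) = ((size P).+1 ^ k)%N.
Proof.
elim: k => [|k ih]; first by [].
transitivity (size [seq add_entry y c | y <- sparse_seq P k,
  c <- None :: [seq Some c | c <- P]]); first by [].
by rewrite size_allpairs ih /= size_map expnSr.
Qed.

Lemma mem_sparse_seq P k (u : seq I) (y : I -> R) : uniq u -> (size u <= k)%N ->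
  (forall i, i \notin u -> y i = 0) -> (forall i, i \in u -> (i, y i) \in P) ->
  y \in sparse_seq P k.
Proof.
elim: k u y => [|k ih] [|i u] y // uu su y0 yP.
- rewrite inE; apply/eqP/funext => i; exact: y0.
- apply/allpairsP; exists (y, None) => /=; split=> //.
  exact: (ih [::]).
- have /andP[iu uu'] := uu.
  apply/allpairsP.
  exists (fun j => if j == i then 0 else y j, Some (i, y i)) => /=; split.
  + apply: (ih u) => // j ju.
      by case: eqVneq => // ji; rewrite y0// inE negb_or ji.
    case: eqVneq => [ji|ji]; first by rewrite -ji ju in iu.
    by apply: yP; rewrite inE ju orbT.
  + by rewrite inE/=; apply: map_f; apply: yP; rewrite inE eqxx.
  + by apply/funext => j; case: eqVneq => // ->; rewrite add0r.
Qed.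

End sparse.

(** * Rounding to a grid of step [t] *)

Section quantizer.
Context {R : realType}.
Variable t : R.
Hypothesis t0 : 0 < t.

Definition quantize (a : R) : R := Num.sg a * (t * (Num.truncn (`|a| / t))%:R).

Let trunc_bounds (a : R) : t * (Num.truncn (`|a| / t))%:R <= `|a| <
  t * (Num.truncn (`|a| / t))%:R + t.
Proof.
have a0 : 0 <= `|a| / t by rewrite divr_ge0// ltW.
have /andP[h1 h2] := truncn_itv a0.
rewrite mulrC -ler_pdivlMr// h1/=.
by rewrite -[X in _ + X]mul1r -mulrDl -ltr_pdivrMr// natr1.
Qed.

Lemma quantize_abs (a : R) : `|quantize a| <= `|a|.
Proof.
have /andP[h1 h2] := trunc_bounds a.
rewrite normrM; have [->|a0] := eqVneq a 0; first by rewrite sgr0 normr0 mul0r.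
rewrite normr_sg a0 mul1r ger0_norm// mulr_ge0// ltW//.
Qed.

(** Both bounds are used together: [t] supplies the small factor [t^(2-r)], and [|a|] the summable
    [|a|^r]. *)
Lemma quantize_err (a : R) : `|a - quantize a| <= Num.min t `|a|.
Proof.
have /andP[h1 h2] := trunc_bounds a; rewrite /quantize.
have : 0 <= t * (Num.truncn (`|a| / t))%:R by rewrite mulr_ge0// ltW.
move: h1 h2; set z := t * _; rewrite le_min !ler_norml.
by case: (sgrP a) => [->|a0|a0]; rewrite ?mul0r ?mul1r ?mulN1r; lra.
Qed.

Lemma quantize_eq0 (a : R) : `|a| < t -> quantize a = 0.
Proof.
move=> at0; have a0 : 0 <= `|a| / t by rewrite divr_ge0// ltW.
rewrite /quantize (_ : Num.truncn _ = 0%N) ?mulr0//.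
by apply/eqP; rewrite truncn_eq// a0/= ltr_pdivrMr// mul1r.
Qed.

Definition grid V : seq R :=
  [seq t * z%:R | z <- iota 0 V.+1] ++ [seq - (t * z%:R) | z <- iota 0 V.+1].

Lemma size_grid V : size (grid V) = (2 * V.+1)%N.
Proof. by rewrite size_cat !size_map !size_iota addnn mul2n. Qed.

Lemma mem_grid (K a : R) : `|a| <= K -> quantize a \in grid (Num.truncn (K / t)).
Proof.
move=> aK; rewrite mem_cat /quantize; have zK : Num.truncn (`|a| / t) \in
    iota 0 (Num.truncn (K / t)).+1.
  by rewrite mem_iota/= add0n ltnS le_truncn// ler_pM2r ?invr_gt0.
move: (Num.truncn (`|a| / t)) zK => z zK; apply/orP; case: (sgrP a) => _.
- left; rewrite mul0r; apply/mapP; exists 0%N; last by rewrite mulr0.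
  by rewrite mem_iota.
- by left; rewrite mul1r; apply/mapP; exists z.
- by right; rewrite mulN1r; apply/mapP; exists z.
Qed.

End quantizer.

(** * Codecs for sets with geometrically decaying block sums *)

Section decay_codec.
Context {R : realType} {I : choiceType} (blk : I -> nat).
Hypothesis blkfin : forall m, finite_set (block blk m).
Variables (S : set (I -> R)) (r g C A : R) (d : nat).
Hypotheses (r0 : 0 < r) (r2 : r < 2) (g0 : 0 < g).
Hypothesis Sdecay : forall x m, S x ->
  \sum_(i <- fblock blk m) `|x i| `^ r <= C * 2 `^ (- (g * m.+1%:R)).
Hypothesis cardA : forall m, #|` fblock blk m|%:R <= A * 2 `^ (d%:R * m.+1%:R).

Let C' := C / (2 `^ g - 1).
Let K := C' `^ r^-1.

Definition first_blocks L : {fset I} :=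
  (\bigcup_(m <- iota 0 L) fblock blk m)%fset.

Lemma in_first_blocks L i : (i \in first_blocks L) = (blk i < L)%N.
Proof.
apply/bigfcupP/idP => [[m]|iL].
  by rewrite mem_iota andbT in_fblock// => mL /eqP ->.
by exists (blk i); rewrite ?mem_iota ?iL// in_fblock.
Qed.

(** The crude bound [L <= 2^L] suffices, since the cardinality enters the word length only through
    its logarithm. *)
Lemma card_first_blocks L :
  (size (first_blocks L))%:R <= A * 2 `^ ((d%:R + 1) * L%:R).
Proof.
have A0 : 0 <= A.
  rewrite -(pmulr_lge0 _ (pow2_gt0 (d%:R * 1%:R))); apply: le_trans (cardA 0).
  exact: ler0n.
have := @sum_fset_blocks R I blk blkfin (fun=> 1) 0 L (first_blocks L).
rewrite sumr_const_seq mul1r => /(_ (fun=> ler01)) h.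
apply: (le_trans (h _)); first by move=> i; rewrite in_first_blocks.
apply: (@le_trans _ _ (\sum_(0 <= m < L) A * 2 `^ (d%:R * L%:R))).
  rewrite !big_nat; apply: ler_sum => m /andP[_ mL].
  rewrite sumr_const_seq mul1r; apply: (le_trans (cardA m)).
  by rewrite ler_wpM2l// ler_pow2// ler_wpM2l// ler_nat.
rewrite sumr_const_seq size_iota subn0 -mulrA ler_wpM2l// mulrDl mul1r pow2D.
by rewrite ler_wpM2l ?pow2_ge0// pow2_natr ler_nat ltnW// ltn_expl.
Qed.

Section quantized.
Variables (t : R) (L : nat) (x : I -> R).
Hypotheses (t0 : 0 < t) (Sx : S x).

Definition quantized : I -> R :=
  fun i => if (blk i < L)%N then quantize t (x i) else 0.

Lemma quantized_abs i : `|quantized i| <= `|x i|.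
Proof.
by rewrite /quantized; case: ifP => _; rewrite ?quantize_abs// normr0.
Qed.

Lemma quantized_l2 : l2 quantized.
Proof.
have /l2P[D xD] := decay_sub_l2 blkfin r0 r2 g0 Sdecay Sx.
apply/l2P; exists D => X; apply: le_trans (xD X); apply: ler_sum => i _.
rewrite -[leLHS]real_normK ?num_real// -[leRHS]real_normK ?num_real//.
by rewrite lerXn2r ?nnegrE ?quantized_abs.
Qed.

Lemma quantized_err : sumle (fun i => (x i - quantized i) ^+ 2)
  (t `^ (2 - r) * C' + K `^ (2 - r) * (C' * 2 `^ (- (g * L%:R)))).
Proof.
move=> X; rewrite (big_fsetID _ (fun i => blk i < L)%N)/= lerD//.
  apply: (@le_trans _ _ (\sum_(i <- [fset i in X | (blk i < L)%N]%fset)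
      t `^ (2 - r) * `|x i| `^ r)).
    rewrite !big_seq; apply: ler_sum => i; rewrite !inE /quantized => /andP[_ ->].
    have := quantize_err t0 (x i); rewrite le_min => /andP[h1 h2].
    rewrite -[leLHS]real_normK ?num_real//.
    apply: (le_trans (sqr_le_powR (normr_ge0 _) h1 r0 r2)).
    rewrite ler_wpM2l ?powR_ge0// ge0_ler_powR ?nnegrE ?(ltW r0)//.
  rewrite -mulr_sumr ler_wpM2l ?powR_ge0//; exact: decay_sumle Sx _.
rewrite (eq_big_seq (fun i => x i ^+ 2)); last first.
  by move=> i; rewrite !inE /quantized => /andP[_ /negbTE ->]; rewrite subr0.
apply: decay_sqr_tail Sx _ => // i; rewrite !inE => /andP[_].
by rewrite -leqNgt.
Qed.

Definition codebook : seq (I -> R) :=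
  sparse_seq [seq (i, a) | i <- first_blocks L, a <- grid t (Num.truncn (K / t))]
    (Num.truncn (C' / t `^ r)).

Lemma mem_codebook : quantized \in codebook.
Proof.
(* Smaller entries are rounded to 0, so these indices carry the support. *)
pose P i := t <= `|x i|.
apply: (mem_sparse_seq (u := [seq i <- first_blocks L | P i])).
- by rewrite filter_uniq// fset_uniq.
- have tr0 : 0 < t `^ r by exact: powR_gt0.
  (* Markov's inequality: each selected entry contributes at least [t^r] to a sum bounded by
     [C']. *)
  have h : (size [seq i <- first_blocks L | P i])%:R <= C' / t `^ r.
    rewrite ler_pdivlMr// mulrC -sumr_const_seq big_filter.
    apply: (@le_trans _ _ (\sum_(i <- first_blocks L | P i) `|x i| `^ r)).
      apply: ler_sum => i Pi.
      by rewrite ge0_ler_powR ?nnegrE ?(ltW r0) ?(ltW t0).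
    rewrite big_fset_condE; exact: decay_sumle Sx _.
  by rewrite truncn_ge_nat// (le_trans _ h).
- move=> i; rewrite mem_filter in_first_blocks /quantized.
  case: ifP => // iL; rewrite andbT -ltNge => xi; exact: quantize_eq0.
- move=> i; rewrite mem_filter in_first_blocks /quantized => /andP[_ iL].
  rewrite iL; apply/allpairsP; exists (i, quantize t (x i)) => /=; split=> //.
    by rewrite in_first_blocks.
  by apply: mem_grid => //; exact: (decay_bound blkfin r0 g0 Sdecay i Sx).
Qed.

End quantized.

Lemma size_codebook t L :
  size (codebook t L) = ((size (first_blocks L) * (2 * (Num.truncn (K / t)).+1)).+1
    ^ Num.truncn (C' / t `^ r))%N.
Proof.
by rewrite size_sparse_seq size_allpairs size_grid.
Qed.

(** At most [C' 2^(th j)] entries are stored, each with O(j) bits for position and value; as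
    [th < 1], the total is eventually below [2^j]. *)
Lemma codebook_fits th (Q : nat) : 0 <= th -> th < 1 -> 0 <= C' ->
  exists j0, forall j, (j0 <= j)%N ->
    (size (codebook (2 `^ (- (j%:R * th / r))) (Q * j)) <= 2 ^ (2 ^ j))%N.
Proof.
move=> th0 th1 C0.
have A0 : 0 <= A.
  rewrite -(pmulr_lge0 _ (pow2_gt0 (d%:R * 1%:R))); apply: le_trans (cardA 0).
  exact: ler0n.
have K0 : 0 <= K by exact: powR_ge0.
pose b := (Num.truncn (1 + 2 * A * (K + 1))).+1.
have bP : 1 + 2 * A * (K + 1) <= 2 `^ b%:R.
  rewrite pow2_natr; apply: ltW; apply: (lt_le_trans (truncnS_gt _)).
  by rewrite ler_nat ltnW// ltn_expl.
(* Bits per unit of [j]: [(d + 1) Q] for a position in the first [Q j] blocks and [th / r] for a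
   value on the grid. The constant factors go into [b]. *)
pose B := (d%:R + 1) * Q%:R + th / r.
have thr0 : 0 <= th / r by rewrite divr_ge0// ltW.
have B0 : 0 <= B by rewrite addr_ge0// mulr_ge0// addr_ge0.
have th1' : 0 < 1 - th by rewrite subr_gt0.
have [j0 j0P] := linear_le_pow2 ((B + b%:R) * C') th1'.
exists j0 => j /j0P hj; rewrite size_codebook.
set t := 2 `^ _; set N := size _; set V := Num.truncn _; set k := Num.truncn _.
have kP : k%:R <= C' * 2 `^ (j%:R * th).
  have : k%:R <= C' / t `^ r by rewrite truncn_le divr_ge0 ?powR_ge0.
  rewrite -powRN /t -powRrM.
  have -> // : - (j%:R * th / r) * - r = j%:R * th by field; rewrite gt_eqF.
have VP : V.+1%:R <= (K + 1) * 2 `^ (j%:R * th / r).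
  have : V%:R <= K / t by rewrite truncn_le divr_ge0 ?powR_ge0.
  rewrite -powRN opprK => h; rewrite -natr1 mulrDl lerD// mul1r.
  rewrite -[leLHS](powRr0 2) ler_pow2// -mulrA mulr_ge0//.
have NVP : ((N * (2 * V.+1)).+1%:R : R) <= 2 `^ ((B + b%:R) * j.+1%:R).
  rewrite -natr1 !natrM.
  apply: (@le_trans _ _ ((1 + 2 * A * (K + 1)) * 2 `^ (B * j%:R))).
    rewrite [leRHS]mulrDl mul1r [leLHS]addrC lerD//.
      by rewrite -[leLHS](powRr0 2) ler_pow2// mulr_ge0.
    have NP : N%:R <= A * 2 `^ ((d%:R + 1) * (Q * j)%:R) by exact: card_first_blocks.
    have -> : 2 * A * (K + 1) * 2 `^ (B * j%:R) =
       (A * 2 `^ ((d%:R + 1) * (Q * j)%:R)) * (2 * ((K + 1) * 2 `^ (j%:R * th / r))).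
      have -> : B * j%:R = (d%:R + 1) * (Q * j)%:R + j%:R * th / r.
        by rewrite /B natrM; ring.
      by rewrite pow2D; ring.
    by rewrite ler_pM// ler_wpM2l.
  apply: (@le_trans _ _ (2 `^ b%:R * 2 `^ (B * j%:R))).
    by rewrite ler_wpM2r ?pow2_ge0.
  rewrite -pow2D ler_pow2//.
  have -> : (B + b%:R) * j.+1%:R = b%:R + B * j%:R + (B + b%:R * j%:R).
    by rewrite -natr1; ring.
  by rewrite lerDl addr_ge0// mulr_ge0.
rewrite -(ler_nat R) natrX -pow2_natr.
apply: (@le_trans _ _ ((2 `^ ((B + b%:R) * j.+1%:R)) ^+ k)).
  by rewrite lerXn2r ?nnegrE ?pow2_ge0.
rewrite -powR_mulrn ?pow2_ge0// -powRrM ler_pow2//.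
apply: (@le_trans _ _ ((B + b%:R) * j.+1%:R * (C' * 2 `^ (j%:R * th)))).
  by rewrite ler_wpM2l// mulr_ge0// addr_ge0.
have -> : (2 ^ j)%N%:R = 2 `^ ((1 - th) * j%:R) * 2 `^ (j%:R * th) :> R.
  by rewrite -pow2D -pow2_natr; congr (_ `^ _); ring.
rewrite mulrA ler_wpM2r ?pow2_ge0//; apply: le_trans hj.
by rewrite le_eqVlt; apply/orP; left; apply/eqP; ring.
Qed.

Lemma decay_codec s : S !=set0 -> 0 <= s -> s < r^-1 - 2^-1 ->
  codec_with_rate S s.
Proof.
move=> [x0 Sx0] s0 sr.
have C0 : 0 <= C'.
  have := decay_sumle blkfin g0 Sdecay Sx0 fset0.
  by rewrite big_seq_fset0.
(* Chosen so that [t = 2^(-j th / r)] gives [t^(2-r) = 2^(-2 s j)]; then [th < 1] is the assumption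
   [s < 1/r - 1/2]. *)
pose th := 2 * s * r / (2 - r).
have r2' : 0 < 2 - r by rewrite subr_gt0.
have th0 : 0 <= th by rewrite divr_ge0 ?mulr_ge0 ?(ltW r0) ?(ltW r2').
have th1 : th < 1.
  rewrite /th ltr_pdivrMr// mul1r -(ltr_pM2r (_ : 0 < r^-1 / 2)); last first.
    by rewrite divr_gt0 ?invr_gt0.
  have -> : 2 * s * r * (r^-1 / 2) = s by field; rewrite gt_eqF.
  have -> // : (2 - r) * (r^-1 / 2) = r^-1 - 2^-1 by field; rewrite gt_eqF.
(* Keeping [Q j] blocks brings the tail factor [2^(-g Q j)] below [2^(-2 s j)]. *)
pose Q := (Num.truncn (2 * s / g)).+1.
have QP : 2 * s <= g * Q%:R by rewrite [leRHS]mulrC -ler_pdivrMr//; apply: ltW; exact: truncnS_gt.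
have [j0 j0P] := codebook_fits Q th0 th1 C0.
(* The last factor covers the lengths with [j < j0], where 0 is the only codeword. *)
pose D := C' * (1 + K `^ (2 - r)) * 2 `^ (2 * s * j0%:R).
have KC : 0 <= C' * (1 + K `^ (2 - r)) by rewrite mulr_ge0// addr_ge0 ?powR_ge0.
apply: (@codec_of_covering _ _ _ s D) => // [|j].
  by rewrite mulr_ge0 ?pow2_ge0.
have [jj|jj] := leqP j0 j.
  pose t : R := 2 `^ (- (j%:R * th / r)).
  have t0 : 0 < t by exact: pow2_gt0.
  exists (codebook t (Q * j)); split; first exact: j0P.
  move=> x Sx; exists (quantized t (Q * j) x); split.
  - exact: mem_codebook.
  - exact: quantized_l2.
  move=> X; apply: (le_trans (@quantized_err t (Q * j) x t0 Sx X)).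
  apply: (@le_trans _ _ (C' * (1 + K `^ (2 - r)) * 2 `^ (- (2 * s * j%:R)))).
    rewrite mulrDr mulr1 mulrDl lerD//.
      rewrite mulrC ler_wpM2l// /t -powRrM ler_pow2//.
      rewrite le_eqVlt; apply/orP; left; apply/eqP.
      by rewrite /th; field; rewrite ?gt_eqF.
    rewrite [leLHS]mulrCA -[leRHS]mulrA ler_wpM2l// ler_wpM2l ?powR_ge0// ler_pow2//.
    by rewrite lerN2 natrM mulrA ler_wpM2r.
  rewrite ler_wpM2r ?pow2_ge0// ler_peMr//.
  by rewrite -[leLHS](powRr0 2) ler_pow2// !mulr_ge0.
exists [:: fun=> 0]; split; first by rewrite expn_gt0.
move=> x Sx; exists (fun=> 0); split; first by rewrite inE.
  by apply/l2P; exists 0 => X; rewrite big1// => i _; rewrite expr0n.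
move=> X; under eq_bigr do rewrite subr0.
apply: (le_trans (decay_sqr_tail blkfin r0 r2 g0 Sdecay (L := 0%N) Sx _)) => //.
rewrite mulr0 oppr0 powRr0 mulr1 -/C' -/K mulrC.
rewrite /D -mulrA -pow2D.
apply: (@le_trans _ _ (C' * (1 + K `^ (2 - r)))).
  by rewrite ler_wpM2l// lerDr.
rewrite ler_peMr// -[leLHS](powRr0 2) ler_pow2//.
by rewrite subr_ge0 ler_wpM2l ?mulr_ge0// ler_nat ltnW.
Qed.

End decay_codec.

(** * Binary digits and Lebesgue measure *)

(** Digits are counted from the most significant of [N], as after the binary point of [k / 2^N]. *)
Definition binary_digit (N k j : nat) : bool := odd (k %/ 2 ^ (N - j.+1)).

Lemma binary_digitS N k j (b : bool) : (j < N)%N ->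
  binary_digit N.+1 (k.*2 + b) j = binary_digit N k j.
Proof.
move=> jN; rewrite /binary_digit subSn// expnS divnMA; congr (odd (_ %/ _)).
by rewrite -muln2 divnMDl// divn_small ?addn0//; case: b.
Qed.

Lemma binary_digit_last N k (b : bool) : binary_digit N.+1 (k.*2 + b) N = b.
Proof. by rewrite /binary_digit subnn divn1 oddD odd_double; case: b. Qed.

Lemma sum_double (V : nmodType) (F : nat -> V) M :
  \sum_(0 <= k < M.*2) F k = \sum_(0 <= k < M) (F k.*2 + F k.*2.+1).
Proof.
elim: M => [|M ih]; first by rewrite !big_geq.
by rewrite doubleS !big_nat_recr//= ih addrA.
Qed.

(** Independence of the digits in finite form, by splitting off the last digit. *)
Lemma sum_binary_digits (R : comNzRingType) (w : nat -> bool -> R) N :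
  \sum_(0 <= k < 2 ^ N) \prod_(0 <= j < N) w j (binary_digit N k j) =
  \prod_(0 <= j < N) (w j false + w j true).
Proof.
elim: N => [|N ih]; first by rewrite big_nat1 !big_geq.
rewrite expnS mul2n sum_double big_nat_recr//= -ih mulr_suml.
apply: eq_bigr => k _.
have h (b : bool) : \prod_(0 <= j < N.+1) w j (binary_digit N.+1 (k.*2 + b) j) =
    \prod_(0 <= j < N) w j (binary_digit N k j) * w N b.
  rewrite big_nat_recr//= binary_digit_last; congr (_ * _).
  by rewrite !big_nat; apply: eq_bigr => j /andP[_ jN]; rewrite binary_digitS.
have := h false; have := h true; rewrite addn0 addn1 => -> ->.
by rewrite mulrDr.
Qed.

Section dyadic.
Context {R : realType}.
Implicit Types (t : R) (N k : nat).

Definition cell N t : nat := Num.truncn (2 ^+ N * t).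

Definition digit j t : bool := odd (cell j.+1 t).

Definition unit_itv : set R := `[0, 1[%classic.

Lemma unit_itv_ge0 t : unit_itv t -> 0 <= t.
Proof. by rewrite /unit_itv/= in_itv/= => /andP[]. Qed.

Lemma cell_coarse M N t : 0 <= t -> (M <= N)%N ->
  cell M t = (cell N t %/ 2 ^ (N - M))%N.
Proof.
move=> t0 MN; rewrite /cell; apply: truncn_def.
have y0 : 0 <= 2 ^+ N * t by rewrite mulr_ge0// exprn_ge0.
have /andP[h1 h2] := truncn_itv y0.
set n := Num.truncn _ in h1 h2 *; set w := (2 ^ (N - M))%N.
have w0 : (0 < w)%N by rewrite expn_gt0.
have e : 2 ^+ N * t = 2 ^+ M * t * w%:R.
  by rewrite /w natrX mulrAC -exprD subnKC.
rewrite e in h1 h2.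
rewrite -(ler_pM2r (_ : 0 < w%:R :> R)) ?ltr0n//.
rewrite -[X in _ && X](ltr_pM2r (_ : 0 < w%:R :> R)) ?ltr0n//.
rewrite -!natrM; apply/andP; split.
  by apply: le_trans h1; rewrite ler_nat leq_trunc_div.
by apply: (lt_le_trans h2); rewrite ler_nat ltn_ceil.
Qed.

Lemma digit_cell N j t : 0 <= t -> (j < N)%N ->
  digit j t = binary_digit N (cell N t) j.
Proof. by move=> t0 jN; rewrite /digit (cell_coarse t0 jN). Qed.

Definition dyadic N k : set R :=
  `[k%:R / 2 ^+ N, k.+1%:R / 2 ^+ N[%classic.

Lemma dyadicP N k t : 0 <= t -> dyadic N k t <-> cell N t = k.
Proof.
move=> t0; have N0 : 0 < 2 ^+ N :> R by rewrite exprn_gt0.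
rewrite /dyadic/= in_itv/= ler_pdivrMr// ltr_pdivlMr// mulrC.
split; first by move=> h; exact: truncn_def.
by move=> <-; apply: truncn_itv; rewrite mulr_ge0// ltW.
Qed.

Lemma cell_lt N t : unit_itv t -> (cell N t < 2 ^ N)%N.
Proof.
rewrite /unit_itv/= in_itv/= => /andP[t0 t1].
rewrite /cell truncn_lt_nat ?mulr_ge0 ?exprn_ge0//.
by rewrite natrX gtr_pMr// exprn_gt0.
Qed.

Lemma measurable_dyadic N k : measurable (dyadic N k).
Proof. exact: measurable_itv. Qed.

Lemma lebesgue_dyadic N k : lebesgue_measure (dyadic N k) = ((2 ^+ N)^-1)%:E.
Proof.
rewrite /dyadic lebesgue_measure_itv/= lte_fin ltr_pM2r ?invr_gt0 ?exprn_gt0//.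
by rewrite ltr_nat ltnSn -EFinB -mulrBl -natr1 addrAC subrr add0r mul1r.
Qed.

Lemma lebesgue_unit_itv : lebesgue_measure unit_itv = 1%E.
Proof. by rewrite /unit_itv lebesgue_measure_itv/= lte_fin ltr01 oppr0 adde0. Qed.

Lemma measurable_unit_itv : measurable unit_itv.
Proof. exact: measurable_itv. Qed.

(** Reduces a measure estimate to counting: the cells selected by [P] cover [A], and each has mass
    [2^(-N)]. *)
Lemma lebesgue_cells_le N (P : pred nat) (A : set R) : measurable A ->
  A `<=` unit_itv -> (forall t, A t -> P (cell N t)) ->
  (lebesgue_measure A <= ((\sum_(0 <= k < 2 ^ N | P k) 1) / 2 ^+ N)%:E)%E.
Proof.
move=> mA A1 AP.
pose F k := if P k then dyadic N k else set0.
have mF k : measurable (F k).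
  by rewrite /F; case: ifP => // _; exact: measurable_dyadic.
have AF : A `<=` \big[setU/set0]_(k < 2 ^ N) F k.
  move=> t At; rewrite -bigcup_mkord; exists (cell N t) => /=.
    by apply: cell_lt; exact: A1.
  rewrite /F AP//; apply/dyadicP => //; exact/unit_itv_ge0/A1.
have := @content_subadditive _ _ _ (@lebesgue_measure R) A F (2 ^ N)%N
  (fun k _ => mF k) mA AF.
move/le_trans; apply.
rewrite -(big_mkord xpredT (fun k => lebesgue_measure (F k))).
rewrite mulr_suml -sumEFin [leRHS]big_mkcond/=; apply: lee_sum => k _.
by rewrite /F; case: ifP => _; rewrite ?measure0// lebesgue_dyadic mul1r.
Qed.

End dyadic.

(** * Random sign sequences *)

Section pushforward.
Context {R : realType} {I : choiceType}.
Variables (S : set (I -> R)) (Phi : R -> I -> R).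
Hypotheses (St : small_tails S) (Sl2 : S `<=` l2).
Hypothesis PhiS : forall t, unit_itv t -> S (Phi t).
Hypothesis Phi_cell : forall i, exists N0, forall N t t', (N0 <= N)%N ->
  unit_itv t -> unit_itv t' -> cell N t = cell N t' -> Phi t i = Phi t' i.

Definition Phi_preimage (A : set (I -> R)) : set R := unit_itv `&` Phi @^-1` A.

Lemma Phi_cell_fset (X : {fset I}) : exists N, forall t t',
  unit_itv t -> unit_itv t' -> cell N t = cell N t' ->
  forall i, i \in X -> Phi t i = Phi t' i.
Proof.
have [f fP] := choice Phi_cell.
exists (\max_(i <- X) f i)%N => t t' ut ut' tt' i iX.
apply: fP tt' => //.
exact: (@leq_bigmax_seq _ _ xpredT f _ iX).
Qed.

(** By the small tails, finitely many coordinates of [Phi t], hence finitely many digits of [t],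
    already force membership in [U]. The preimage is therefore a countable union of dyadic cells. *)
Lemma measurable_Phi_preimage_open (U : set (I -> R)) : l2_open U ->
  measurable (Phi_preimage (S `&` U)).
Proof.
move=> Uo.
pose G N k : set R := unit_itv `&` dyadic N k.
rewrite (_ : Phi_preimage _ = \bigcup_N \bigcup_k
  (if `[< G N k `<=` Phi @^-1` U >] then G N k else set0)).
  apply: bigcup_measurable => N _; apply: bigcup_measurable => k _.
  case: ifP => // _; apply: measurableI; first exact: measurable_unit_itv.
  exact: measurable_dyadic.
apply/seteqP; split=> [t [ut [_ Ut]]|t [N _ [k _]]]; last first.
  case: ifPn => // /asboolP GU Gt; split; first by case: Gt.
  by split; [apply: PhiS; case: Gt|exact: GU].
have [[X e] /= e0 h] := small_tails_fnbhs St Sl2 Uo (PhiS ut) Ut.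
have [N NP] := Phi_cell_fset X.
exists N => //; exists (cell N t) => //.
rewrite ifT; first by split=> //; exact/dyadicP/erefl/unit_itv_ge0.
apply/asboolP => t' [ut' /(dyadicP _ _ (unit_itv_ge0 ut')) tt'].
have [|nS|//] := h (Phi t').
  by move=> i iX; rewrite (NP _ _ ut ut' (esym tt') i iX) subrr normr0.
by case: nS; exact: PhiS.
Qed.

Lemma measurable_Phi_preimage (A : set (I -> R)) : trace_borel S A ->
  measurable (Phi_preimage A).
Proof.
apply: (@smallest_sub _ _ _ [set A | measurable (Phi_preimage A)]); last first.
  by move=> _ [U Uo <-]; exact: measurable_Phi_preimage_open.
split=> /=.
- by rewrite /Phi_preimage preimage_set0 setI0.
- move=> B mB; rewrite (_ : Phi_preimage _ = unit_itv `\` Phi_preimage B).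
    by apply: measurableD => //; exact: measurable_unit_itv.
  apply/seteqP; split=> t [ut h]; split=> //.
    by case=> _; case: h.
  by split; [exact: PhiS|move=> Bt; exact: h].
- move=> F mF; rewrite /Phi_preimage preimage_bigcup setI_bigcupr.
  by apply: bigcup_measurable => k _; exact: mF.
Qed.

Definition Phi_prob (A : set (I -> R)) : R := fine (lebesgue_measure (Phi_preimage A)).

Lemma Phi_probE (A : set (I -> R)) : trace_borel S A ->
  lebesgue_measure (Phi_preimage A) = (Phi_prob A)%:E.
Proof.
move=> /measurable_Phi_preimage mA; rewrite fineK//.
rewrite ge0_fin_numE//; apply: (@le_lt_trans _ _ 1%E); last exact: ltry.
rewrite -(@lebesgue_unit_itv R); apply: le_measure; rewrite ?inE//.
  exact: measurable_unit_itv.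
exact: subIsetl.
Qed.

Lemma Phi_preimage_setT : Phi_preimage S = unit_itv.
Proof. by apply/seteqP; split=> [t []//|t ut]; split=> //; exact: PhiS. Qed.

Lemma Phi_prob_borel : borel_prob S Phi_prob.
Proof.
split.
- by rewrite /Phi_prob /Phi_preimage preimage_set0 setI0 measure0.
- by move=> A _; rewrite fine_ge0.
- by rewrite /Phi_prob Phi_preimage_setT lebesgue_unit_itv.
move=> F bF tF.
have mF k := measurable_Phi_preimage (bF k).
have bU : trace_borel S (\bigcup_k F k).
  by have [_ _ hU] := smallest_sigma_algebra S [set S `&` U | U in l2_open]; exact: hU.
have Ueq : Phi_preimage (\bigcup_k F k) = \bigcup_k Phi_preimage (F k).
  by rewrite /Phi_preimage preimage_bigcup setI_bigcupr.
have tP : trivIset setT (fun k => Phi_preimage (F k)).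
  apply/trivIsetP => i j _ _ ij; rewrite -subset0 => t [[_ Fi] [_ Fj]].
  move/trivIsetP : tF => /(_ i j Logic.I Logic.I ij); rewrite -subset0 => h.
  exact: (h (Phi t)).
have mU : measurable (\bigcup_k Phi_preimage (F k)) by exact: bigcup_measurable.
have := @measure_semi_sigma_additive _ _ _ (@lebesgue_measure R) _ mF tP mU.
rewrite -Ueq [X in _ --> X](_ : _ = (Phi_prob (\bigcup_k F k))%:E); last exact: Phi_probE.
move/fine_cvg.
apply: cvg_trans; apply: near_eq_cvg; near=> n => /=.
rewrite (eq_bigr (fun k => (Phi_prob (F k))%:E)); last by move=> k _; exact: Phi_probE.
by rewrite sumEFin big_mkord.
Unshelve. all: by end_near. Qed.

(** The union bound, which turns an estimate for the mass of balls into a lower bound for the size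
    of a covering. *)
Lemma Phi_prob_cover (M : nat) (Z : nat -> set (I -> R)) (b : R) :
  (forall k, trace_borel S (Z k)) -> S `<=` \bigcup_(k in `I_M) Z k ->
  (forall k, Phi_prob (Z k) <= b) -> 1 <= M%:R * b.
Proof.
move=> bZ SZ Zb.
have h : unit_itv `<=` \big[setU/set0]_(k < M) Phi_preimage (Z k).
  move=> t ut; rewrite -(bigcup_mkord M (fun k => Phi_preimage (Z k))); have [k kM Zk] := SZ _ (PhiS ut).
  by exists k.
have : (lebesgue_measure unit_itv <=
    \sum_(k < M) lebesgue_measure (Phi_preimage (Z k)))%E.
  apply: (@content_subadditive _ _ _ (@lebesgue_measure R) unit_itv
    (fun k => Phi_preimage (Z k)) M) => //.
    by move=> k _; exact: measurable_Phi_preimage.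
  exact: measurable_unit_itv.
rewrite lebesgue_unit_itv.
under eq_bigr do rewrite (Phi_probE (bZ _)).
rewrite sumEFin lee_fin => /le_trans; apply.
apply: (@le_trans _ _ (\sum_(k < M) b)); first exact: ler_sum.
by rewrite sumr_const card_ord mulr_natl.
Qed.

(** Up to the factor [2^N], the expectation of [2^(-w)] for the number [w] of wrong signs: each
    index contributes independently the mean [3/4] of 1 and [1/2]. *)
Lemma prod_halves (X : {fset I}) (idx : I -> nat) (pos : I -> bool) (N : nat) :
  {in X &, injective idx} -> (forall i, i \in X -> (idx i < N)%N) ->
  \sum_(0 <= k < 2 ^ N)
    \prod_(i <- X) (if binary_digit N k (idx i) == pos i then 1 else 2^-1 : R) =
  2 ^+ N * (3 / 4) ^+ #|` X|.
Proof.
move=> inj XN.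
have prodE (F : I -> R) : \prod_(i <- X) F i =
    \prod_(0 <= j < N) \prod_(i <- X | idx i == j) F i.
  rewrite (exchange_big_dep xpredT)//= !big_seq; apply: eq_bigr => i iX.
  rewrite [RHS]big_mkcond (bigD1_seq (idx i)) ?iota_uniq ?mem_index_iota ?XN//=.
  by rewrite eqxx big1 ?mulr1// => m; rewrite eq_sym => /negbTE ->.
pose w j b : R := \prod_(i <- X | idx i == j) (if b == pos i then 1 else 2^-1).
transitivity (\sum_(0 <= k < 2 ^ N) \prod_(0 <= j < N) w j (binary_digit N k j)).
  apply: eq_bigr => k _; rewrite prodE; apply: eq_bigr => j _.
  by apply: eq_bigr => i /eqP ->.
rewrite sum_binary_digits.
(* By injectivity of [idx] a digit governs at most one index, so the product is empty or has a
   single factor. *)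
have wE j : w j false + w j true = 2 * \prod_(i <- X | idx i == j) (3 / 4).
  rewrite /w -[X in X + _ = _]big_filter -[X in _ + X = _]big_filter.
  rewrite -[X in _ = _ * X]big_filter; set s := [seq i <- X | _].
  have su : uniq s by rewrite filter_uniq// fset_uniq.
  have sX i : i \in s -> i \in X /\ idx i = j.
    by rewrite mem_filter => /andP[/eqP].
  case: s su sX => [|i [|i' s]] /= su sX; rewrite ?big_nil ?big_seq1.
  - by rewrite mulr1.
  - by case: (pos i) => /=; field.
  - have [iX ij] := sX i (mem_head _ _).
    have [i'X i'j] : i' \in X /\ idx i' = j by apply: sX; rewrite !inE eqxx orbT.
    move: su; rewrite inE negb_or => /andP[/andP[/negP ii' _] _].
    by exfalso; apply: ii'; apply/eqP; apply: inj => //; rewrite ij i'j.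
under eq_bigr do rewrite wE.
rewrite big_split/= -prodE; congr (_ * _).
  by rewrite prodr_const_nat subn0.
by rewrite big_const_seq count_predT iter_mulr_1.
Qed.

(** Exponential Markov inequality: the indicator of [wrong <= (e/c)^2] is at most
    [2^((e/c)^2 - wrong)], whose mean is computed by [prod_halves]. *)
Lemma Phi_prob_cball (X : {fset I}) (idx : I -> nat) (c e : R) (y : I -> R) :
  {in X &, injective idx} -> 0 < c -> 0 <= e ->
  (forall t i, i \in X -> Phi t i = if digit (idx i) t then c else - c) ->
  Phi_prob (S `&` l2_cball y e) <= 2 `^ ((e / c) ^+ 2) * (3 / 4) ^+ #|` X|.
Proof.
move=> inj c0 e0 PhiX.
have bB := trace_borel_cball y Sl2 e0.
pose N := (\max_(i <- X) (idx i).+1)%N.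
have XN i : i \in X -> (idx i < N)%N.
  by move=> iX; exact: (@leq_bigmax_seq _ _ xpredT (fun i => (idx i).+1) _ iX).
(* The sign of the centre, 0 counting as positive: a sample entry of the other sign is at least [c]
   away from [y i]. *)
pose pos i := 0 <= y i.
pose wrong k : R := \sum_(i <- X) (binary_digit N k (idx i) != pos i)%:R.
have wrongP t : Phi_preimage (S `&` l2_cball y e) t ->
    wrong (cell N t) <= (e / c) ^+ 2.
  move=> [ut [_ [_ /(l2norm_leP _ e0) h]]].
  rewrite expr_div_n ler_pdivlMr ?exprn_gt0//; apply: le_trans (h X).
  rewrite mulr_suml !big_seq; apply: ler_sum => i iX.
  rewrite PhiX// (digit_cell (unit_itv_ge0 ut) (XN i iX)) /pos.
  case: (binary_digit _ _ _); case: (leP 0 (y i)) => yi; rewrite /= ?mul0r ?sqr_ge0//.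
    by rewrite mul1r -(sqrrN (y i - c)) lerXn2r ?nnegrE; lra.
  by rewrite mul1r lerXn2r ?nnegrE; lra.
have := @lebesgue_cells_le R N (fun k => wrong k <= (e / c) ^+ 2) _
  (measurable_Phi_preimage bB) (@subIsetl _ _ _) wrongP.
rewrite Phi_probE// lee_fin => /le_trans; apply.
rewrite ler_pdivrMr ?exprn_gt0// mulrAC -mulrA.
rewrite -(@prod_halves X idx pos N inj XN) mulr_sumr big_mkcond.
apply: ler_sum => k _.
have -> : \prod_(i <- X) (if binary_digit N k (idx i) == pos i then 1 else 2^-1) =
    2 `^ (- wrong k).
  rewrite /wrong; elim: (X : seq I) => [|i s ih].
    by rewrite !big_nil oppr0 powRr0.
  rewrite !big_cons ih opprD pow2D; case: eqVneq => _ /=.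
    by rewrite oppr0 powRr0.
  by rewrite powR_inv1.
case: ifPn => [h|_]; last by rewrite mulr_ge0 ?pow2_ge0.
by rewrite -pow2D -[leLHS](powRr0 2) ler_pow2// subr_ge0.
Qed.

End pushforward.

(** * The ball *)

Lemma sum_telescoping_le1 (R : realType) :
  sumle (fun m : nat => ((m.+1 * m.+2)%N%:R : R)^-1) 1.
Proof.
move=> X; pose L := (\max_(m <- X) m.+1)%N.
(* The partition of [nat] into singletons lets the block lemma pass from [X] to an initial range. *)
have fin m : finite_set (block (id : nat -> nat) m).
  by rewrite /block preimage_id; exact: finite_set1.
have f0 (m : nat) : 0 <= ((m.+1 * m.+2)%N%:R : R)^-1 by rewrite invr_ge0.
apply: (le_trans (@sum_fset_blocks R nat id fin _ 0 L X f0 _)).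
  by move=> m mX; exact: (@leq_bigmax_seq _ _ xpredT (fun i => i.+1) _ mX).
rewrite (eq_bigr (fun m : nat => - (m.+2%:R : R)^-1 - - (m.+1%:R)^-1)); last first.
  move=> m _; rewrite (_ : fblock id m = [fset m]%fset); last first.
    by apply/fsetP => i; rewrite in_fblock// inE.
  rewrite big_seq_fset1 natrM -[m.+2%:R]natr1.
  have : 0 < m.+1%:R :> R by rewrite ltr0n.
  move: (m.+1%:R) => y y0; field.
  by rewrite !gt_eqF// addr_gt0.
rewrite telescope_sumr// opprK invr1.
by rewrite gerDr oppr_le0 invr_ge0.
Qed.

Lemma pow2_ln (R : realType) (w : R) : 0 < w -> 2 `^ (ln w / ln 2) = w.
Proof.
move=> w0; rewrite /powR pnatr_eq0/= divfK ?lnK//.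
by rewrite gt_eqF// ln_gt0// ltr1n.
Qed.

(** Rests on [(3/4)^4 = 81/256 < 1/2]. *)
Lemma three_quarters_le (R : realType) (n : nat) :
  (3 / 4 : R) ^+ n <= 2 `^ (- (n%:R / 4)).
Proof.
have h : (3 / 4 : R) <= 2 `^ (- 4^-1).
  have -> : (3 / 4 : R) = ((3 / 4) ^+ 4) `^ 4^-1.
    by rewrite -powR_mulrn// -powRrM divff ?powRr1.
  have -> : (2 `^ (- 4^-1) : R) = 2^-1 `^ 4^-1.
    by rewrite -(@powR_inv1 R 2)// -powRrM mulN1r.
  by rewrite ge0_ler_powR ?nnegrE//; lra.
have -> : - (n%:R / 4) = - 4^-1 * n%:R :> R by ring.
by rewrite powRrM powR_mulrn ?pow2_ge0// lerXn2r ?nnegrE ?pow2_ge0.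
Qed.

(** * Compactness, optimal rate and random signs on the ball *)

Section ball_measure.
Context {R : realType} {I : choiceType}.
Variables (d : nat) (blk : I -> nat) (p q : \bar R) (alpha a A : R).
Variable idx : I -> nat.
Hypotheses (idx_inj : injective idx) (d0 : (0 < d)%N).
Hypothesis blkfin : forall m, finite_set (block blk m).
Hypothesis a0 : 0 < a.
Hypothesis carda : forall m, a * 2 `^ (d%:R * m.+1%:R) <= #|` fblock blk m|%:R.
Hypothesis cardA : forall m, #|` fblock blk m|%:R <= A * 2 `^ (d%:R * m.+1%:R).
Hypotheses (p0 : (0 < p)%E) (q0 : (0 < q)%E).
Hypothesis alpha_gt : d%:R * Num.max 0 (2^-1 - inv_ext p) < alpha.

Let S : set (I -> R) := mixed_ball blk p q alpha.
Let ip := inv_ext p.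
Let iq := inv_ext q.
Let sstar := alpha / d%:R - (2^-1 - ip).
Let n m := #|` fblock blk m|.

Let dR : 0 < d%:R :> R. Proof. by rewrite ltr0n. Qed.

Let ip0 : 0 <= ip.
Proof.
by rewrite /ip; case: p p0 => [r||]//=; rewrite lte_fin invr_ge0 => /ltW.
Qed.

Let iq0 : 0 <= iq.
Proof.
by rewrite /iq; case: q q0 => [r||]//=; rewrite lte_fin invr_ge0 => /ltW.
Qed.

Let alpha0 : 0 < alpha.
Proof.
by apply: le_lt_trans alpha_gt; rewrite mulr_ge0// le_max lexx.
Qed.

Let sstar0 : 0 < sstar.
Proof.
rewrite /sstar subr_gt0 ltr_pdivlMr// mulrC; apply: le_lt_trans alpha_gt.
by rewrite ler_wpM2l ?(ltW dR)// le_max lexx orbT.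
Qed.

Let n0 m : 0 < (n m)%:R :> R.
Proof. by apply: lt_le_trans (carda m); rewrite mulr_gt0 ?pow2_gt0. Qed.

Lemma ball_decay_exists s : 0 <= s -> s < sstar ->
  exists r g, [/\ 0 < r, r < 2, 0 < g, s < r^-1 - 2^-1 &
    forall x m, S x ->
      \sum_(i <- fblock blk m) `|x i| `^ r <= (A + 1) * 2 `^ (- (g * m.+1%:R))].
Proof.
move=> s0 ss.
pose sigma := alpha / d%:R + ip.
(* The value of [1/r]: above [1/p] for the decay estimate, above [s + 1/2] for the rate and for
   [r < 2], below [sigma] for [g > 0]. *)
pose u := (Num.max ip (s + 2^-1) + sigma) / 2.
have su : s + 2^-1 < sigma by move: ss; rewrite /sstar /sigma; lra.
have ipu : ip < sigma by rewrite /sigma ltrDr divr_gt0.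
have mu : Num.max ip (s + 2^-1) < sigma by rewrite gt_max ipu su.
have m1 : ip <= Num.max ip (s + 2^-1) by rewrite le_max lexx.
have m2 : s + 2^-1 <= Num.max ip (s + 2^-1) by rewrite le_max lexx orbT.
have u1 : ip < u by rewrite /u; lra.
have u2 : s + 2^-1 < u by rewrite /u; lra.
have u3 : u < sigma by rewrite /u; lra.
have u0 : 0 < u by exact: le_lt_trans u1.
exists u^-1, (u^-1 * (alpha + d%:R * ip) - d%:R); split.
- by rewrite invr_gt0.
- by rewrite invf_plt ?posrE//; lra.
- have -> : u^-1 * (alpha + d%:R * ip) - d%:R = (sigma - u) * (d%:R / u).
    by rewrite /sigma; field; rewrite !gt_eqF.
  by apply: mulr_gt0; [rewrite subr_gt0|exact: divr_gt0].
- by rewrite invrK; lra.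
- move=> x m Sx; apply: (mixed_ball_decay blkfin p0 q0 cardA) => //.
    by rewrite invr_gt0.
  by rewrite mulrC ler_pdivrMr// mul1r ltW.
Qed.

Lemma ball_l2_compact : l2_compact S /\ l2_borel S /\ small_tails S /\ S `<=` l2.
Proof.
have [r [g [r0 r2 g0 _ dec]]] := ball_decay_exists (lexx 0) sstar0.
have Sl2 : S `<=` l2 by exact: (decay_sub_l2 blkfin r0 r2 g0 dec).
have Sc : fin_closed S by exact: mixed_ball_fin_closed.
split; first exact: (decay_l2_compact blkfin r0 r2 g0 dec Sc).
split; first exact: fin_closed_l2_borel.
split=> //; exact: (decay_small_tails blkfin r0 r2 g0 dec).
Qed.

Lemma ball_codec s : 0 <= s -> s < sstar -> codec_with_rate S s.
Proof.
move=> s0 ss; have [r [g [r0 r2 g0 sr dec]]] := ball_decay_exists s0 ss.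
apply: (decay_codec blkfin r0 r2 g0 dec cardA) => //.
exists (fun=> 0); apply/(mixed_ballP blkfin) => //.
have v0 m : 2 `^ (alpha * m.+1%:R) * bnorm blk p (fun=> 0) m = 0.
  suff -> : bnorm blk p (fun=> 0) m = 0 by rewrite mulr0.
  case: p p0 => [t||]//=; rewrite ?lte_fin => t0.
    rewrite big1 ?powR0 ?invr_neq0 ?gt_eqF// => i _.
    by rewrite normr0 powR0 ?gt_eqF.
  by rewrite normr0; elim/big_ind: _ => // x y -> ->; rewrite maxxx.
case: q q0 => [t||]// t0; last by move=> m; rewrite v0.
move=> X; rewrite big1// => m _; rewrite v0 powR0 ?gt_eqF//.
Qed.

(* With [q] finite, the [q]-th powers sum to [1], and the decay is only polynomial. *)
Definition weight m : R := ((m.+1 * m.+2)%N%:R) `^ (- iq).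

(** The power of [n m] normalizes: a block with all entries of this modulus has l^p norm
    [weight m * 2^(-alpha (m+1))]. *)
Definition amplitude m : R :=
  weight m * 2 `^ (- (alpha * m.+1%:R)) * (n m)%:R `^ (- ip).

Definition sample (t : R) (i : I) : R :=
  if digit (idx i) t then amplitude (blk i) else - amplitude (blk i).

Lemma amplitude_gt0 m : 0 < amplitude m.
Proof. by rewrite !mulr_gt0 ?powR_gt0// ltr0n muln_gt0. Qed.

Lemma sample_norm t m i : i \in fblock blk m -> `|sample t i| = amplitude m.
Proof.
rewrite in_fblock// /sample => /eqP ->.
by case: ifP => _; rewrite ?normrN gtr0_norm ?amplitude_gt0.
Qed.

Lemma sample_bnorm t m :
  2 `^ (alpha * m.+1%:R) * bnorm blk p (sample t) m <= weight m.
Proof.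
rewrite -ler_pdivlMl ?pow2_gt0// -powRN [leRHS]mulrC.
have -> : weight m * 2 `^ (- (alpha * m.+1%:R)) = amplitude m * (n m)%:R `^ ip.
  rewrite /amplitude -mulrA -powRD ?addNr ?powRr0 ?mulr1//.
  by rewrite eqxx/= gt_eqF.
rewrite /ip; case: p p0 => [r||]//=; rewrite ?lte_fin => r0.
  rewrite (eq_big_seq (fun=> amplitude m `^ r)); last first.
    by move=> i im; rewrite (sample_norm t im).
  rewrite sumr_const_seq powRM ?powR_ge0// -powRrM mulfV ?gt_eqF// powRr1//.
  exact/ltW/amplitude_gt0.
rewrite powRr0 mulr1 big_seq; elim/big_ind: _ => //.
- exact/ltW/amplitude_gt0.
- by move=> x y hx hy; rewrite ge_max hx.
- by move=> i im; rewrite (sample_norm t im).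
Qed.

Lemma sample_ball t : S (sample t).
Proof.
apply/(mixed_ballP blkfin) => //.
have := sample_bnorm t; rewrite /weight /iq.
case: q q0 => [r||]//=; rewrite ?lte_fin => r0 h; last first.
  by move=> m; apply: le_trans (h m) _; rewrite oppr0 powRr0.
move=> X; apply: le_trans (@sum_telescoping_le1 R X); apply: ler_sum => m _.
rewrite -powR_inv1//.
have -> : ((m.+1 * m.+2)%N%:R : R) `^ (-1) = (((m.+1 * m.+2)%N%:R) `^ (- r^-1)) `^ r.
  by rewrite -powRrM mulNr mulVf ?gt_eqF.
by rewrite ge0_ler_powR ?nnegrE ?powR_ge0 ?(ltW r0)// mulr_ge0 ?pow2_ge0 ?bnorm_ge0.
Qed.

Lemma sample_cell i : exists N0, forall N t t', (N0 <= N)%N ->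
  unit_itv t -> unit_itv t' -> cell N t = cell N t' -> sample t i = sample t' i.
Proof.
exists (idx i).+1 => N t t' iN ut ut' tt'.
by rewrite /sample !(@digit_cell _ N) ?(unit_itv_ge0 ut) ?(unit_itv_ge0 ut')// tt'.
Qed.

Let P := Phi_prob sample.

Lemma sample_prob_borel : borel_prob S P.
Proof.
have [_ [_ [St Sl2]]] := ball_l2_compact.
apply: Phi_prob_borel => //; [by move=> t _; exact: sample_ball|exact: sample_cell].
Qed.

Lemma weight_lower delta : 0 < delta -> exists2 k : R, 0 < k &
  forall m, k * 2 `^ (- (delta * m.+1%:R)) <= weight m.
Proof.
move=> delta0; have iq1 : 0 < iq + 1 by rewrite ltr_wpDl.
(* Dividing by [iq + 1] instead of [iq] includes the case [iq = 0] of [q = +oo]. *)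
have [k k0 kP] := pow2_quadratic (divr_gt0 delta0 iq1).
exists ((k ^+ 2) `^ iq); first by rewrite powR_gt0// exprn_gt0.
move=> m; rewrite /weight !powRN -[leRHS]div1r ler_pdivlMr; last first.
  by rewrite powR_gt0// ltr0n muln_gt0.
rewrite mulrAC ler_pdivrMr ?pow2_gt0// mul1r -powRM ?exprn_ge0 ?(ltW k0)//.
apply: (@le_trans _ _ ((2 `^ (delta / (iq + 1) * m.+1%:R)) `^ iq)).
  rewrite ge0_ler_powR ?nnegrE ?pow2_ge0 ?mulr_ge0 ?exprn_ge0 ?(ltW k0)//.
  apply: le_trans (kP _ (ler0n _ m.+1)).
  rewrite exprMn ler_wpM2l ?exprn_ge0 ?(ltW k0)// natr1 -natrX ler_nat.
  by rewrite expnS expn1 leq_mul.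
rewrite -powRrM ler_pow2//.
have -> : delta / (iq + 1) * m.+1%:R * iq = (iq / (iq + 1)) * (delta * m.+1%:R).
  by field; rewrite gt_eqF.
by rewrite ler_piMl ?mulr_ge0 ?(ltW delta0)// ler_pdivrMr// mul1r lerDl.
Qed.

(** The sign of [h] decides which of the two cardinality bounds applies; [1/2 - 1/p] can have either
    sign. *)
Lemma card_power_lower h : exists2 k : R, 0 < k &
  forall m, k * 2 `^ (d%:R * m.+1%:R * h) <= (n m)%:R `^ h.
Proof.
have A0 : 0 < A.
  rewrite -(pmulr_lgt0 _ (pow2_gt0 (d%:R * 1%:R))); apply: lt_le_trans (cardA 0).
  exact: n0.
have [h0|h0] := leP 0 h.
  exists (a `^ h); first exact: powR_gt0.
  move=> m; rewrite powRrM -powRM ?pow2_ge0 ?(ltW a0)//.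
  by rewrite ge0_ler_powR ?nnegrE ?mulr_ge0 ?pow2_ge0 ?(ltW a0).
exists (A `^ h); first exact: powR_gt0.
move=> m; rewrite powRrM -powRM ?pow2_ge0 ?(ltW A0)//.
have [g g0 ->] : exists2 g, 0 <= g & h = - g.
  by exists (- h); rewrite ?opprK// oppr_ge0 ltW.
rewrite !powRN lef_pV2 ?posrE ?powR_gt0 ?mulr_gt0 ?pow2_gt0//.
rewrite ge0_ler_powR ?nnegrE ?mulr_ge0 ?pow2_ge0 ?(ltW A0)//; exact: cardA.
Qed.

(** The right side is the l2 norm of a block of a sample, of order [weight m * 2^(-d sstar (m+1))];
    the slack [s - sstar] absorbs the weight. *)
Lemma amplitude_lower s : sstar < s -> exists2 k : R, 0 < k &
  forall m, k * 2 `^ (- (d%:R * s * m.+1%:R)) <=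
    amplitude m * (n m)%:R `^ 2^-1.
Proof.
move=> ss; have [k k0 kP] := card_power_lower (2^-1 - ip).
have del0 : 0 < d%:R * (s - sstar) by rewrite mulr_gt0// subr_gt0.
have [l l0 lP] := weight_lower del0.
exists (l * k); first exact: mulr_gt0.
move=> m; rewrite /amplitude -[leRHS]mulrA -powRD; last first.
  by rewrite implybE (gt_eqF (n0 m)) orbT.
rewrite [- ip + _]addrC.
apply: (@le_trans _ _ (l * 2 `^ (- (d%:R * (s - sstar) * m.+1%:R)) *
   2 `^ (- (alpha * m.+1%:R)) * (k * 2 `^ (d%:R * m.+1%:R * (2^-1 - ip))))).
  rewrite le_eqVlt; apply/orP; left; apply/eqP.
  transitivity (l * k * (2 `^ (- (d%:R * (s - sstar) * m.+1%:R)) *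
    2 `^ (- (alpha * m.+1%:R)) * 2 `^ (d%:R * m.+1%:R * (2^-1 - ip)))); last by ring.
  congr (_ * _); rewrite -!pow2D; congr (_ `^ _).
  by rewrite /sstar; field; rewrite gt_eqF.
rewrite ler_pM ?mulr_ge0 ?pow2_ge0 ?(ltW l0) ?(ltW k0)//.
by rewrite ler_wpM2r ?pow2_ge0.
Qed.

(** The radius is such that [(e/c)^2 <= n/8] for the amplitude [c], which uses up half of the gain
    [(3/4)^n <= 2^(-n/4)]. *)
Lemma sample_small_ball m (y : I -> R) e : 0 <= e ->
  e <= amplitude m * (n m)%:R `^ 2^-1 / Num.sqrt 8 ->
  P (S `&` l2_cball y e) <= 2 `^ (- ((n m)%:R / 8)).
Proof.
move=> e0 em; have [_ [_ [St Sl2]]] := ball_l2_compact.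
have am := amplitude_gt0 m.
have := @Phi_prob_cball R I S sample St Sl2 (fun t _ => sample_ball t) sample_cell
  (fblock blk m) idx (amplitude m) e y (in2W idx_inj) am e0.
move=> /(_ _)/le_trans; apply.
  by move=> t i; rewrite in_fblock// /sample => /eqP ->.
apply: (@le_trans _ _ (2 `^ ((n m)%:R / 8) * 2 `^ (- ((n m)%:R / 4)))).
  rewrite ler_pM ?pow2_ge0 ?exprn_ge0//; last exact: three_quarters_le.
  apply: ler_pow2.
  have -> : (n m)%:R / 8 = ((n m)%:R `^ 2^-1 / Num.sqrt 8) ^+ 2 :> R.
    by rewrite expr_div_n sqr_sqrtr// powR12_sqrt// sqr_sqrtr.
  rewrite lerXn2r ?nnegrE ?divr_ge0 ?powR_ge0 ?sqrtr_ge0 ?(ltW am)//.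
  by rewrite ler_pdivrMr// mulrC mulrA.
rewrite -pow2D ler_pow2// le_eqVlt; apply/orP; left; apply/eqP; by field.
Qed.

Lemma sample_growth : growth_order S P sstar.
Proof.
move=> s ss; have s0 : 0 < s by exact: lt_trans ss.
have [k k0 kP] := amplitude_lower ss.
pose K := k / Num.sqrt 8.
have K0 : 0 < K by rewrite divr_gt0// sqrtr_gt0.
have ds0 : 0 < d%:R * s by rewrite mulr_gt0.
(* The first constant forces [z > 1] below, so that a block is available. In the second, [2^(-d)]
   pays for rounding [z] down and [1/8] comes from [sample_small_ball]. *)
exists (K * 2 `^ (- (d%:R * s))), (a * 2 `^ (- d%:R) * K `^ s^-1 / 8).
split; first by rewrite mulr_gt0 ?pow2_gt0.
split; first by rewrite !mulr_gt0 ?pow2_gt0 ?powR_gt0.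
move=> y e _ e0 eK.
have Ke0 : 0 < K / e by rewrite divr_gt0.
(* Solves [K 2^(-d s z) = e]; with [m + 1] its integer part, [m] is the last block whose guaranteed
   radius [K 2^(-d s (m+1))] is at least [e]. *)
pose z := ln (K / e) / ln 2 / (d%:R * s).
have zE : 2 `^ (d%:R * s * z) = K / e.
  by rewrite mulrC /z divfK ?gt_eqF// pow2_ln.
have z1 : 1 < z.
  rewrite ltNge; apply/negP => z1; move: eK; apply/negP; rewrite -leNgt.
  rewrite powRN ler_pdivrMr ?pow2_gt0// mulrC -ler_pdivrMr// -zE ler_pow2//.
  by rewrite -[leRHS]mulr1 ler_wpM2l ?(ltW ds0).
have /andP[M1 M2] := truncn_itv (ltW (lt_trans ltr01 z1)).
have : (0 < Num.truncn z)%N by rewrite truncn_gt0 ltW.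
case E : (Num.truncn z) => [//|m] _; rewrite E in M1 M2.
apply: (le_trans (@sample_small_ball m y e (ltW e0) _)).
  apply: (@le_trans _ _ (K * 2 `^ (- (d%:R * s * m.+1%:R)))).
    rewrite powRN ler_pdivlMr ?pow2_gt0// mulrC -ler_pdivlMr// -zE ler_pow2//.
    by rewrite ler_wpM2l ?(ltW ds0).
  rewrite /K mulrAC ler_wpM2r ?invr_ge0 ?sqrtr_ge0//.
apply: ler_pow2; rewrite lerN2 mulrAC ler_wpM2r//.
apply: le_trans (carda m); rewrite -2!mulrA ler_wpM2l ?(ltW a0)//.
rewrite -[leLHS]mulrA.
have -> : K `^ s^-1 * e `^ (- s^-1) = 2 `^ (d%:R * z).
  have -> : d%:R * z = d%:R * s * z * s^-1 by field; rewrite gt_eqF.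
  rewrite [RHS]powRrM zE powRM ?invr_ge0 ?(ltW K0) ?(ltW e0)//; congr (_ * _).
  by rewrite -(powR_inv1 (ltW e0)) -powRrM mulN1r.
rewrite -pow2D ler_pow2//.
have : d%:R * z <= d%:R * m.+2%:R by rewrite ler_wpM2l ?(ltW dR)// ltW.
rewrite -[m.+2%:R]natr1; lra.
Qed.

(** For [s > s' > sstar] and words of [N = 2^j] bits, [2^N] balls of radius [e] of order [N^(-s)]
    cover [S], each of mass at most [2^(-c e^(-1/s'))]. The exponent is of order [N^(s/s')], which
    outgrows [N], so the total mass would be below 1. *)
Lemma codec_rate_le s : codec_with_rate S s -> s <= sstar.
Proof.
move=> [E [D [Dl2 [C CP]]]]; rewrite leNgt; apply/negP => ss.
pose s' := (s + sstar) / 2.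
have s's : s' < s by rewrite /s'; lra.
have ss' : sstar < s' by rewrite /s'; lra.
have s'0 : 0 < s' by exact: lt_trans ss'.
have s0 : 0 < s by exact: lt_trans s's.
have [e0 [c [e00 [c0 gr]]]] := sample_growth ss'.
have [_ [_ [St Sl2]]] := ball_l2_compact.
(* Positive even if [C] is not, so that the balls have positive radius. *)
pose C1 := `|C| + 1.
have C10 : 0 < C1 by rewrite ltr_wpDl.
pose c' := c * C1 `^ (- s'^-1).
have c'0 : 0 < c' by rewrite mulr_gt0 ?powR_gt0.
have rho0 : 0 < s / s' - 1 by rewrite subr_gt0 ltr_pdivlMr// mul1r.
(* [j1] makes the exponent of the mass bound exceed [N]; [j2] brings the radius below [e0]. *)
have [j1 j1P] := linear_le_pow2 (c'^-1 + 1) rho0.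
have [j2 j2P] := linear_le_pow2 (C1 / e0 + 1) s0.
pose j := maxn j1 j2.
have := j1P j (leq_maxl _ _); have := j2P j (leq_maxr _ _).
have jge1 : 1 <= j.+1%:R :> R by rewrite ler1n.
move=> h2 h1; pose N := (2 ^ j)%N; pose e := C1 * 2 `^ (- (s * j%:R)).
have N0 : (0 < N)%N by rewrite expn_gt0.
have ep : 0 < e by rewrite mulr_gt0 ?pow2_gt0.
have ee0 : e < e0.
  rewrite /e powRN ltr_pdivrMr ?pow2_gt0// mulrC -ltr_pdivrMr//.
  apply: lt_le_trans h2; apply: (@lt_le_trans _ _ (C1 / e0 + 1)).
    by rewrite ltrDl.
  by rewrite ler_peMr// addr_ge0// divr_ge0 ?(ltW C10) ?(ltW e00).
pose words := enum {: N.-tuple bool}.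
pose Z k := S `&` l2_cball (D N (nth [tuple of nseq N false] words k)) e.
have bZ k : trace_borel S (Z k) by exact: (trace_borel_cball _ Sl2 (ltW ep)).
have SZ : S `<=` \bigcup_(k in `I_(2 ^ N)%N) Z k.
  move=> x Sx; exists (index (E N x) words).
    have <- : size words = (2 ^ N)%N by rewrite -cardE card_tuple card_bool.
    by rewrite /= index_mem mem_enum.
  split=> //; split; first exact: Sl2.
  rewrite nth_index ?mem_enum//.
  have Ns0 : 0 < N%:R `^ s :> R by rewrite powR_gt0 ?ltr0n.
  have : ((N%:R `^ s)%:E * l2dist x (D N (E N x)) <= C%:E)%E.
    apply: le_trans (CP N N0); apply: lee_wpmul2l; first by rewrite lee_fin ltW.
    by apply: ereal_sup_ubound; exists x.
  rewrite l2distC; have : (0 <= l2dist (D N (E N x)) x)%E by exact: poweR_ge0.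
  case: (l2dist _ _) => [t||]// t0; last by rewrite gt0_muley ?lte_fin// leye_eq.
  rewrite -EFinM !lee_fin mulrC -ler_pdivlMr// => /le_trans; apply.
  rewrite /e powRN [s * _]mulrC powRrM pow2_natr -/N.
  by rewrite ler_wpM2r ?invr_ge0 ?powR_ge0// /C1 ler_wpDr// ler_norm.
have := @Phi_prob_cover R I S sample St Sl2 (fun t _ => sample_ball t) sample_cell
  (2 ^ N)%N Z _ bZ SZ (fun k => gr _ _ (Dl2 N _) ep ee0).
rewrite -pow2_natr -pow2D; apply/negP; rewrite -ltNge.
set w := _ - _; suff w0 : w < 0.
  by rewrite -[w]opprK powRN invf_lt1 ?pow2_gt0// pow2_gt1// oppr_gt0.
rewrite /w subr_lt0.
have -> : c * e `^ (- s'^-1) = c' * 2 `^ ((s / s' - 1) * j%:R) * N%:R.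
  rewrite /N -pow2_natr -mulrA -pow2D /e powRM ?pow2_ge0 ?(ltW C10)// -powRrM.
  by rewrite /c' mulrA; congr (_ * 2 `^ _); field; rewrite gt_eqF.
rewrite -[ltLHS]mul1r ltr_pM2r ?ltr0n//.
apply: (@lt_le_trans _ _ (c' * ((c'^-1 + 1) * j.+1%:R))).
  rewrite mulrA mulrDr mulfV ?gt_eqF// mulr1.
  apply: (@lt_le_trans _ _ (1 + c')); first by rewrite ltrDl.
  by rewrite ler_peMr// addr_ge0// ltW.
by rewrite ler_wpM2l ?(ltW c'0).
Qed.

Lemma ball_opt_rate : opt_rate S = sstar%:E.
Proof.
apply/eqP; rewrite eq_le; apply/andP; split.
  by apply: ge_ereal_sup => _ [s [s0 Ss] <-]; rewrite lee_fin codec_rate_le.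
apply/lee_addgt0Pr => eps eps0.
(* Clipped at 0, because only nonnegative rates enter the supremum. *)
pose s := Num.max 0 (sstar - eps).
have s0 : 0 <= s by rewrite le_max lexx.
have ss : s < sstar by rewrite gt_max sstar0 ltrBlDr ltrDl.
apply: (@le_trans _ _ (s%:E + eps%:E)%E).
  by rewrite -EFinD lee_fin -lerBlDr le_max lexx orbT.
rewrite leeD2r//; apply: ereal_sup_ubound; exists s => //; split=> //.
exact: ball_codec.
Qed.

End ball_measure.

Lemma d_regular_card (R : realType) (I : choiceType) (d : nat) (blk : I -> nat) :
  @d_regular R I d blk ->
  (forall m, finite_set (block blk m)) /\
  exists a A : R, [/\ 0 < a,
    forall m, a * 2 `^ (d%:R * m.+1%:R) <= #|` fblock blk m|%:R &
    forall m, #|` fblock blk m|%:R <= A * 2 `^ (d%:R * m.+1%:R)].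
Proof.
move=> [a [A [a0 [_ h]]]].
have fin m : finite_set (block blk m).
  by have [n [mn _]] := h m; apply/finite_setP; exists n.
have card m : a * 2 `^ (d%:R * m.+1%:R) <= #|` fblock blk m|%:R <=
    A * 2 `^ (d%:R * m.+1%:R).
  have [n [mn [h1 h2]]] := h m; rewrite -natrM pow2_natr.
  have -> : #|` fblock blk m| = n by apply/card_eq_fsetP; rewrite fset_setK.
  by rewrite h1 h2.
split=> //; exists a, A; split=> // m; by case/andP: (card m).
Qed.

Theorem theorem3p3 (R : realType) (I : choiceType) (d : nat) (blk : I -> nat)
  (p q : \bar R) (alpha : R) :
  countable [set: I] -> infinite_set [set: I] ->
  (0 < d)%N -> @d_regular R I d blk ->
  (0 < p)%E -> (0 < q)%E ->
  d%:R * Num.max 0 (2^-1 - inv_ext p) < alpha ->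
  let S : set (I -> R) := mixed_ball blk p q alpha in
  [/\ l2_compact S, l2_borel S,
      opt_rate S = (alpha / d%:R - (2^-1 - inv_ext p))%:E &
      exists P : set (I -> R) -> R, borel_prob S P /\ critical S P].
Proof.
(* The injection from countability assigns to each index its own binary digit, which makes the signs
   independent. *)
move=> /countable_injP[idx idx_inj] _ d0 reg p0 q0 alpha_gt S.
have [fin [a [A [a0 carda cardA]]]] := d_regular_card reg.
have inj : injective idx by move=> i j; apply: idx_inj; rewrite inE.
have [cS [bS _]] := ball_l2_compact d0 fin cardA p0 q0 alpha_gt.
have rate := ball_opt_rate inj d0 fin a0 carda cardA p0 q0 alpha_gt.
split=> //; exists (Phi_prob (sample blk p q alpha idx)); split.
  exact: (sample_prob_borel idx d0 fin a0 carda cardA p0 q0 alpha_gt).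
exists (alpha / d%:R - (2^-1 - inv_ext p)); split=> //.
exact: (sample_growth inj d0 fin a0 carda cardA p0 q0 alpha_gt).
Qed.
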